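(* Let $\mathcal{H}$ be a real Hilbert space, $C\subseteq\mathcal{H}$ a nonempty closed convex subset, $f:C\to C$ a strict contraction with coefficient $\alpha\in[0,1)$, and $T:C\to C$ a nonexpansive mapping with $Fix(T)\neq\emptyset$. Let $\theta:[0,\infty)\to(0,1]$ be an absolutely continuous function and let $x_0\in C$. Then the dynamical system $$\begin{cases} x'(t)+x(t)=\theta(t)f(x(t))+(1-\theta(t))T(x(t)), & t\ge 0,\\ x(0)=x_0,\end{cases}\qquad\text{(CDS)}$$ has a unique trajectory $x(\cdot)$. Moreover, if in addition $\theta$ satisfies the following three conditions: (i) $\theta(t)\to 0$ as $t\to\infty$; (ii) $\int_0^{+\infty}\theta(t)\,dt=\infty$; (iii) $\int_0^{+\infty}|\theta'(t)|\,dt<\infty$ or $\frac{\theta'(t)}{\theta(t)}\to 0$ as $t\to\infty$; then $x(t)$ converges strongly in $\mathcal{H}$ as $t\to\infty$ to $q^{\ast}$, the unique solution of the variational problem $$\begin{cases} q^{\ast}\in Fix(T),\\ \langle f(q^{\ast})-q^{\ast},\,z-q^{\ast}\rangle\le 0\quad\forall z\in Fix(T).\end{cases}\qquad\text{(VP)}$$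
   Context: $\langle\cdot,\cdot\rangle$ and $\|\cdot\|$ denote the inner product and norm of $\mathcal{H}$. The mapping $f:C\to C$ is a strict contraction with coefficient $\alpha\in[0,1)$ if $\|f(x)-f(y)\|\le\alpha\|x-y\|$ for all $x,y\in C$. The mapping $T:C\to C$ is nonexpansive if $\|T(x)-T(y)\|\le\|x-y\|$ for all $x,y\in C$. $Fix(T)=\{x\in C: T(x)=x\}$. A trajectory of (CDS) is a continuously differentiable function $x:[0,\infty)\to\mathcal{H}$ such that $x(t)\in C$ for every $t\ge0$, $x(0)=x_0$, and $x'(t)+x(t)=\theta(t)f(x(t))+(1-\theta(t))T(x(t))$ for every $t\ge0$. The derivative $\theta'$ of the absolutely continuous function $\theta$ is understood almost everywhere. *)

(* Defs.v *)
From HB Require Import structures.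
From mathcomp Require Import all_boot all_order all_algebra.
From mathcomp Require Import all_classical all_reals all_analysis.
Import Order.TTheory GRing.Theory Num.Theory.
Import numFieldNormedType.Exports.

Set Implicit Arguments.
Unset Strict Implicit.
Unset Printing Implicit Defensive.

Local Open Scope classical_set_scope.
Local Open Scope ring_scope.

(* A real Hilbert space is a complete normed module whose norm is induced by
   a symmetric positive definite bilinear form. *)
Definition induces_norm (R : realType) (H : completeNormedModType R)
    (ip : {dot H for (@idfun R)}) :=
  forall u : H, `|u| = Num.sqrt (ip u u).

Definition nonexpansive (R : realType) (H : normedModType R) (C : set H)
    (T : {fun C >-> C}) :=
  1.-lipschitz_C T.

(* T is a total function on H; only its restriction to C is meaningful, hence
   the intersection with C. *)
Definition Fix (R : realType) (H : normedModType R) (C : set H)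
    (T : {fun C >-> C}) : set H :=
  C `&` [set z | T z = z].

(* The difference quotient is taken within [0, +oo[, so this is the ordinary
   derivative at t > 0 and the right derivative at t = 0. *)
Definition has_derivative_at (R : realType) (H : normedModType R)
    (x : R -> H) (t : R) (v : H) :=
  (s - t)^-1 *: (x s - x t) @[s --> within `[0, +oo[ (t^')] --> v.

(* Trajectories are functions on [0, +oo[; the values of x and dx at negative
   times are irrelevant. *)
Definition trajectory (R : realType) (H : normedModType R) (C : set H)
    (f T : {fun C >-> C}) (theta : R -> R) (x0 : H) (x : R -> H) :=
  [/\ forall t : R, 0 <= t -> C (x t),
      x 0 = x0 &
      exists dx : R -> H,
        [/\ {within `[0, +oo[, continuous dx},
            forall t : R, 0 <= t -> has_derivative_at x t (dx t) &
            forall t : R, 0 <= t ->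
              dx t + x t = theta t *: f (x t) + (1 - theta t) *: T (x t)]].

Definition absolutely_continuous_on (R : realType) (a b : R) (g : R -> R) :=
  forall e : R, 0 < e -> exists2 d : R, 0 < d &
    forall (n : nat) (u v : 'I_n -> R),
      (forall i, [/\ a <= u i, u i < v i & v i <= b]) ->
      trivIset setT (fun i => `]u i, v i[%classic) ->
      \sum_(i < n) (v i - u i) < d ->
      \sum_(i < n) `|g (v i) - g (u i)| < e.

(* Absolute continuity on the half-line is absolute continuity on each compact
   interval [0, b]; it is implied by the epsilon-delta condition on the whole
   of [0, +oo[. *)
Definition absolutely_continuous_halfline (R : realType) (g : R -> R) :=
  forall b : R, absolutely_continuous_on 0 b g.

(* Limit at infinity of a function that is only defined almost everywhere. *)
Definition ae_cvg_pinfty (R : realType) (g : R -> R) (l : R) :=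
  exists2 N : set R, (@lebesgue_measure R).-negligible N &
    g t @[t --> within (~` N) +oo] --> l.

Definition solves_VP (R : realType) (H : completeNormedModType R)
    (ip : {dot H for (@idfun R)}) (C : set H) (f T : {fun C >-> C}) (q : H) :=
  Fix T q /\ forall z, Fix T z -> ip (f q - q) (z - q) <= 0.

(* Main.v *)
(* Write F_t = theta(t) f + (1 - theta(t)) T, a contraction of C with
   coefficient 1 - c theta(t), where c = 1 - alpha; (CDS) reads x' = F_t x - x.

   Existence and uniqueness: for 0 <= h <= 1 the Euler step
   x |-> x + h (F_t x - x) is nonexpansive and maps the convex set C into
   itself, so two e-approximate solutions with the same initial value differ by
   at most 2 e t; Euler polygons therefore converge to a solution in C.

   Asymptotic regularity: the Euler step does not increase the residual
   |F_t x - x|, up to the variation of theta, so |x'| satisfies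
   |x'|' <= - c theta |x'| + K |theta'|, and either alternative of (iii) together
   with (ii) gives x' -> 0, hence x - T x -> 0 by (i).  The measure-theoretic
   form of (iii) is used through Lebesgue's theorem: an absolutely continuous
   theta is the integral of its almost everywhere derivative.  It follows from
   the Radon-Nikodym theorem for the Stieltjes measures of two nondecreasing
   functions whose difference is theta.

   Limit: the resolvent curve z_l - T z_l = l (u - z_l) converges as l -> 0 to
   the projection P u of u on Fix T, and q is the fixed point of P o f.
   Monotonicity of I - T applied to x and z_l, with u = f q, bounds the upper
   limit of <f q - q, x - q> by 0, and Gronwall's inequality for |x - q|^2
   concludes. *)

Require Import Defs.
From HB Require Import structures.
From mathcomp Require Import all_boot all_order all_algebra.
From mathcomp Require Import all_classical all_reals all_analysis.
From mathcomp Require Import measurable_realfun ring lra.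
Import Order.TTheory GRing.Theory Num.Theory.
Import numFieldNormedType.Exports.

Set Implicit Arguments.
Unset Strict Implicit.
Unset Printing Implicit Defensive.

Local Open Scope classical_set_scope.
Local Open Scope ring_scope.

(** * Lebesgue's theorem for absolutely continuous functions *)

Section ac_family.
Context {R : realType}.
Implicit Types (p q : R * R) (s : seq (R * R)) (F : R -> R).

(** [f] and [T] are merely Lipschitz on [C] and [theta] merely absolutely continuous, so the
    velocity of a trajectory need not be differentiable, and an inequality for its norm cannot be
    had by differentiating it. Every differential inequality is therefore a one-step estimate for
    [s] slightly to the right of [t]; [right_locally_nonincreasing] and [gronwall] integrate such
    estimates, and Euler polygons satisfy them as well as exact solutions do. The natural clock is a
    primitive [Theta] of [theta]: contraction acts at rate [c theta], and (ii) says that the clock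
    runs to infinity, so a forcing bounded by [e theta] costs only [e / c] in the limit. Both
    alternatives of (iii) reduce to one estimate, [|theta t - theta s| <= W t - W s + e (Theta t -
    Theta s)] with [0 <= W <= e] from some time on: a multiple of [W] is subtracted from the
    residual before Gronwall's inequality, and the [e] part is a forcing of the above kind.
    Functions on the half-line are extended to negative times through [Num.max 0], which makes their
    continuity two-sided. *)

Definition nonoverlap p q := (p.2 <= q.1) || (q.2 <= p.1).

Lemma nonoverlapC p q : nonoverlap p q = nonoverlap q p.
Proof. by rewrite /nonoverlap orbC. Qed.

(* Absolute continuity on the whole line, with lists of possibly degenerate,
   non-overlapping intervals in place of families of disjoint open ones. *)
Definition ac_family F := forall e, 0 < e -> exists2 d, 0 < d &
  forall s, all (fun p => p.1 <= p.2) s -> pairwise nonoverlap s ->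
    \sum_(p <- s) (p.2 - p.1) < d -> \sum_(p <- s) `|F p.2 - F p.1| < e.

Definition clip (b t : R) := Num.max 0 (Num.min t b).

Lemma clip_homo b : {homo clip b : x y / x <= y}.
Proof.
move=> x y xy; rewrite /clip !maxEle !minEle.
by do ?case: ifPn; rewrite -?ltNge => *; lra.
Qed.

Lemma clip_itv b t : 0 <= b -> 0 <= clip b t <= b.
Proof.
move=> b0; rewrite /clip !maxEle !minEle.
by do ?case: ifPn; rewrite -?ltNge => *; lra.
Qed.

Lemma clip_id b t : 0 <= t <= b -> clip b t = t.
Proof.
move=> tb; rewrite /clip !maxEle !minEle.
by do ?case: ifPn; rewrite -?ltNge => *; lra.
Qed.

Lemma clip_short b x y : x <= y -> clip b y - clip b x <= y - x.
Proof.
rewrite /clip !maxEle !minEle.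
by do ?case: ifPn; rewrite -?ltNge => *; lra.
Qed.

(** Clipping is monotone and shortens, so clipped intervals still do not overlap and are no longer
    in total. Those that degenerate contribute nothing and are dropped, since
    [absolutely_continuous_on] speaks of nonempty intervals. *)
Lemma ac_family_clip F b : 0 <= b -> absolutely_continuous_on 0 b F ->
  ac_family (F \o clip b).
Proof.
move=> b0 acF e /acF[d d0 dF]; exists d => // s s_le s_no s_d.
pose P p := clip b p.1 < clip b p.2.
pose c p := (clip b p.1, clip b p.2).
pose s' := [seq c p | p <- s & P p].
have -> : \sum_(p <- s) `|(F \o clip b) p.2 - (F \o clip b) p.1| =
    \sum_(p <- s') `|F p.2 - F p.1|.
  rewrite /s' big_map big_filter [LHS](bigID P) /= [X in _ + X]big_seq_cond.
  rewrite [X in _ + X]big1 ?addr0// => p /andP[ps].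
  rewrite /P -leNgt => h; have -> : clip b p.2 = clip b p.1.
    by apply/eqP; rewrite eq_le h clip_homo//; exact: (allP s_le).
  by rewrite subrr normr0.
have s'_no : pairwise nonoverlap s'.
  rewrite pairwise_map; apply: (sub_pairwise (r := nonoverlap)); last first.
    exact: (subseq_pairwise (filter_subseq _ _)).
  by move=> p q /orP[] h; apply/orP; [left|right]; exact: clip_homo.
have s'_lt i : (i < size s')%N -> P (nth (0, 0) [seq p <- s | P p] i) /\
    nth (0, 0) s' i = c (nth (0, 0) [seq p <- s | P p] i).
  rewrite size_map => si; split; last by rewrite (nth_map (0, 0)).
  by have /(all_nthP (0, 0)) := filter_all P s; exact.
rewrite (big_nth (0, 0)) big_mkord.
apply: (dF _ (fun i => (nth (0, 0) s' i).1) (fun i => (nth (0, 0) s' i).2)).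
- move=> i; have [Pi ->] := s'_lt i (ltn_ord i); rewrite /c/=.
  have := clip_itv (nth (0, 0) [seq p <- s | P p] i).1 b0.
  have := clip_itv (nth (0, 0) [seq p <- s | P p] i).2 b0.
  by move=> /andP[_ ->] /andP[-> _].
- apply/trivIsetP => i j _ _ ij; rewrite -subset0 => x/= [].
  rewrite !in_itv/= => /andP[ix xi] /andP[jx xj].
  have : nonoverlap (nth (0, 0) s' i) (nth (0, 0) s' j).
    have := ij; rewrite neq_ltn => /orP[] h.
      by move/(pairwiseP (0, 0)) : s'_no; apply => //; exact: ltn_ord.
    rewrite nonoverlapC.
    by move/(pairwiseP (0, 0)) : s'_no; apply => //; exact: ltn_ord.
  by move=> /orP[] h; lra.
- have := big_mkord predT (fun i => (nth (0, 0) s' i).2 - (nth (0, 0) s' i).1).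
  move=> <-; rewrite -(big_nth _ predT (fun p => p.2 - p.1)).
  apply: le_lt_trans s_d; rewrite /s' big_map big_filter big_mkcond/=.
  rewrite big_seq [leRHS]big_seq; apply: ler_sum => p /(allP s_le) h.
  by case: ifP => _ /=; [exact: clip_short|rewrite subr_ge0].
Qed.

End ac_family.

(** * Absolute continuity of the total variation function *)

Section total_variation_ac.
Context {R : realType}.
Implicit Types (p q : R * R) (s : seq (R * R)) (F : R -> R) (l : seq R).

Definition gaps (a : R) l : seq (R * R) := zip (a :: l) l.

Lemma gaps_cons a x l : gaps a (x :: l) = (a, x) :: gaps x l.
Proof. by []. Qed.

Lemma gaps_le a l : path <%R a l -> all (fun p => p.1 <= p.2) (gaps a l).
Proof.
by elim: l a => // x l IH a /andP[ax /IH xl]; rewrite gaps_cons /= ltW.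
Qed.

Lemma path_le_last a l : path <%R a l -> a <= last a l.
Proof.
elim: l a => //= x l IH a /andP[/ltW ax /IH]; exact: le_trans.
Qed.

Lemma gaps_outside a l q : path <%R a l -> q.2 <= a \/ last a l <= q.1 ->
  all (nonoverlap q) (gaps a l).
Proof.
elim: l a => // x l IH a /andP[ax xl] aq; rewrite gaps_cons /=.
apply/andP; split.
  apply/orP; case: aq => [|h]; [by left|right => /=].
  by apply: le_trans h; rewrite /=; apply: path_le_last.
by apply: IH => //; case: aq => h; [left; rewrite (le_trans h)// ltW|right].
Qed.

Lemma gaps_nonoverlap a l : path <%R a l -> pairwise nonoverlap (gaps a l).
Proof.
elim: l a => // x l IH a /andP[ax xl]; rewrite gaps_cons /= IH// andbT.
by apply: gaps_outside => //; left.
Qed.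

Lemma gaps_length a l : \sum_(p <- gaps a l) (p.2 - p.1) = last a l - a.
Proof.
elim: l a => [a|x l IH a]; first by rewrite big_nil subrr.
by rewrite gaps_cons big_cons IH /=; lra.
Qed.

Lemma gaps_variation F a b l :
  \sum_(p <- gaps a l) `|F p.2 - F p.1| = variation a b F l.
Proof.
elim: l a => [a|x l IH a]; first by rewrite big_nil /variation big_geq.
rewrite gaps_cons big_cons IH /variation /= big_nat_recl//=.
Qed.

(** The [d] belonging to [e = 1] bounds the variation by 1 on intervals shorter than [d]; [[a, b]]
    is cut into finitely many pieces of length at most [d / 2], half of [d] because the bound asks
    for a strict inequality. *)
Lemma ac_family_bounded_variation F a b : ac_family F -> a <= b ->
  bounded_variation a b F.
Proof.
move=> acF ab; have [d d0 dF] := acF 1 ltr01.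
have short u v : u <= v -> v - u < d -> (total_variation u v F <= 1)%E.
  move=> uv uvd; apply: ge_ereal_sup => _ [_ [l [ul /eqP lv] <-] <-].
  rewrite lee_fin -gaps_variation ltW//; apply: dF.
  - exact: gaps_le.
  - exact: gaps_nonoverlap.
  - by rewrite gaps_length lv.
have long n u v : u <= v -> v - u <= n%:R * (d / 2) ->
    (total_variation u v F <= n%:R%:E)%E.
  elim: n u v => [|n IH] u v uv.
    rewrite mul0r subr_le0 => vu.
    have -> : v = u by apply/eqP; rewrite eq_le uv vu.
    by rewrite total_variationxx.
  rewrite -natr1 mulrDl mul1r => h.
  pose c := Num.max u (v - d / 2).
  have uc : u <= c by rewrite le_max lexx.
  have cv : c <= v by rewrite ge_max uv; lra.
  rewrite (total_variationD _ uc cv) EFinD; apply: leeD.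
    apply: IH => //; rewrite /c maxEle; case: ifPn; last first.
      by rewrite subrr => _; rewrite mulr_ge0//; lra.
    lra.
  apply: short => //; have : v - d / 2 <= c by rewrite le_max lexx orbT.
  lra.
apply/bounded_variationP => //; rewrite ge0_fin_numE ?total_variation_ge0//.
have d20 : 0 < d / 2 by lra.
apply: le_lt_trans (long (Num.bound ((b - a) / (d / 2))) _ _ ab _) _.
  by rewrite -ler_pdivrMr// ltW// archi_boundP// divr_ge0// ?subr_ge0// ltW.
exact: ltry.
Qed.

(** Each interval is refined by a partition that nearly attains its variation, which keeps the total
    length. The last clause is the induction invariant: refining does not leave the original
    intervals, so refinements of different members do not overlap. *)
Lemma total_variation_approx F s e : ac_family F -> 0 < e ->
  all (fun p => p.1 <= p.2) s -> pairwise nonoverlap s ->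
  exists s', [/\ all (fun p => p.1 <= p.2) s', pairwise nonoverlap s',
    \sum_(p <- s') (p.2 - p.1) = \sum_(p <- s) (p.2 - p.1),
    \sum_(p <- s) fine (total_variation p.1 p.2 F) <=
      \sum_(p <- s') `|F p.2 - F p.1| + e &
    forall q, all (nonoverlap q) s -> all (nonoverlap q) s'].
Proof.
move=> acF; elim: s e => [|p s IH] e e0.
  by exists [::]; split => //; rewrite !big_nil; lra.
move=> /= /andP[ple sle] /andP[pno sno].
have e20 : 0 < e / 2 by lra.
have [s' [sle' sno' slen' svar' sout']] := IH _ e20 sle sno.
have [p12|p12] := eqVneq p.1 p.2.
  exists s'; split => //.
  - by rewrite big_cons -p12 subrr add0r.
  - rewrite big_cons p12 total_variationxx /= add0r (le_trans svar')//; lra.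
  - by move=> q /andP[_ /sout'].
have pfin := (bounded_variationP F ple).1 (ac_family_bounded_variation acF ple).
have [_ [_ [l [pl /eqP lp] <-] <-]] := ub_ereal_sup_adherent e20 pfin.
rewrite -/(total_variation _ _ _) -[total_variation _ _ _]fineK//.
rewrite -EFinB lte_fin => hl.
exists (gaps p.1 l ++ s'); split.
- by rewrite all_cat gaps_le.
- rewrite pairwise_cat gaps_nonoverlap// sno' !andbT; apply/allrelP => x y xg ys.
  rewrite nonoverlapC.
  move: xg; apply/allP/gaps_outside => //; rewrite lp.
  by have /allP/(_ _ ys)/orP[] := sout' _ pno; [right|left].
- by rewrite big_cat big_cons /= gaps_length lp slen'.
- by rewrite big_cat big_cons /= (gaps_variation _ _ p.2); lra.
- move=> q /andP[qp /sout' qs]; rewrite all_cat qs andbT.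
  by apply: gaps_outside => //; rewrite lp; exact/orP.
Qed.

Lemma total_variationB F a u v : ac_family F -> a <= u -> u <= v ->
  fine (total_variation a v F) - fine (total_variation a u F) =
  fine (total_variation u v F).
Proof.
move=> acF au uv; have av := le_trans au uv.
have fin x y : x <= y -> total_variation x y F \is a fin_num.
  by move=> xy; apply/bounded_variationP => //; exact: ac_family_bounded_variation.
by rewrite (total_variationD _ au uv) fineD ?fin// addrC addKr.
Qed.

(** The increment of the variation function over an interval is the variation there. Up to [e / 2],
    these variations add up to a sum of increments of [F] over a family of the same length, and that
    sum is below [e / 2]. *)
Lemma ac_family_total_variation F b : 0 <= b -> ac_family F ->
  ac_family ((fun t => fine (total_variation 0 t F)) \o clip b).
Proof.
move=> b0 acF e e0; have e20 : 0 < e / 2 by lra.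
have [d d0 dF] := acF _ e20; exists d => // s s_le s_no s_d.
pose c p := (clip b p.1, clip b p.2).
have cs_le : all (fun p => p.1 <= p.2) [seq c p | p <- s].
  by rewrite all_map; apply: sub_all s_le => p; exact: clip_homo.
have cs_no : pairwise nonoverlap [seq c p | p <- s].
  rewrite pairwise_map; apply: sub_pairwise s_no => p q.
  by move=> /orP[] h; apply/orP; [left|right]; exact: clip_homo.
have [s' [s'_le s'_no s'_len s'_var _]] :=
  total_variation_approx acF e20 cs_le cs_no.
have -> : \sum_(p <- s) `|((fun t => fine (total_variation 0 t F)) \o clip b) p.2 -
   ((fun t => fine (total_variation 0 t F)) \o clip b) p.1| =
   \sum_(p <- [seq c p | p <- s]) fine (total_variation p.1 p.2 F).
  rewrite big_map big_seq [RHS]big_seq; apply: eq_bigr => p /(allP s_le) ple.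
  have /andP[c0 _] := clip_itv p.1 b0.
  have cc : clip b p.1 <= clip b p.2 by exact: clip_homo.
  by rewrite /= total_variationB// ger0_norm// fine_ge0// total_variation_ge0.
rewrite (le_lt_trans s'_var)// [ltRHS]splitr ltrD2r dF// s'_len.
apply: le_lt_trans s_d; rewrite big_map big_seq [leRHS]big_seq.
by apply: ler_sum => p /(allP s_le); exact: clip_short.
Qed.

End total_variation_ac.

(** * Finite covers by non-overlapping intervals *)

Section merge.
Context {R : realType}.
Implicit Types (p q : R * R) (s : seq (R * R)).

Fixpoint merge_in p s : seq (R * R) :=
  if s is q :: s' then
    if nonoverlap p q then q :: merge_in p s'
    else merge_in (Num.min p.1 q.1, Num.max p.2 q.2) s'
  else [:: p].

Lemma merge_in_le p s : p.1 <= p.2 -> all (fun p => p.1 <= p.2) s ->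
  all (fun p => p.1 <= p.2) (merge_in p s).
Proof.
elim: s p => [|q s IH] p p12 /=; first by rewrite p12.
move=> /andP[q12 s12]; case: ifP => _ /=; first by rewrite q12 IH.
by apply: IH => //=; rewrite ge_min le_max p12.
Qed.

(** If [p] and [r] overlap, an interval that overlaps neither lies on the same side of both, hence
    outside their hull: a growing hull never runs into members already kept. *)
Lemma merge_in_outside q p s : q.1 <= q.2 -> nonoverlap q p ->
  all (nonoverlap q) s -> all (nonoverlap q) (merge_in p s).
Proof.
move=> q12; elim: s p => [|r s IH] p qp /=; first by rewrite qp.
move=> /andP[qr qs]; case: ifPn => pr /=; first by rewrite qr IH.
apply: IH => //; move: qp qr pr; rewrite /nonoverlap /= negb_or -!ltNge.
rewrite le_min ge_max; move=> /orP[] ? /orP[] ? /andP[? ?]; apply/orP.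
- by left; apply/andP.
- by exfalso; lra.
- by exfalso; lra.
- by right; apply/andP.
Qed.

Lemma merge_in_nonoverlap p s : all (fun p => p.1 <= p.2) s ->
  pairwise nonoverlap s -> pairwise nonoverlap (merge_in p s).
Proof.
elim: s p => // q s IH p /= /andP[q12 s12] /andP[qs sno].
case: ifP => pq /=; last exact: IH.
by rewrite IH// andbT merge_in_outside// nonoverlapC.
Qed.

Lemma merge_in_length p s : p.1 <= p.2 -> all (fun p => p.1 <= p.2) s ->
  \sum_(r <- merge_in p s) (r.2 - r.1) <= p.2 - p.1 + \sum_(r <- s) (r.2 - r.1).
Proof.
elim: s p => [|q s IH] p p12 /=; first by rewrite big_seq1 big_nil addr0.
move=> /andP[q12 s12].
case: ifPn => pq; first by rewrite !big_cons addrCA lerD2l IH.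
rewrite (le_trans (IH _ _ s12))//=; first by rewrite ge_min le_max p12.
rewrite big_cons addrA lerD2r /=.
move: pq; rewrite /nonoverlap negb_or -!ltNge minEle maxEle => /andP[? ?].
by do ?case: ifPn; rewrite -?ltNge => *; lra.
Qed.

Lemma merge_in_cover p s x :
  (exists2 r, r \in p :: s & r.1 < x <= r.2) ->
  exists2 r, r \in merge_in p s & r.1 < x <= r.2.
Proof.
elim: s p => [|q s IH] p //= [r]; rewrite !inE.
case: ifPn => pq rpqs rx.
  case/or3P: rpqs => [rp|rq|rs].
  - have [|r' r's r'x] := IH p; first by exists r; rewrite // inE rp.
    by exists r'; rewrite // inE r's orbT.
  - by exists r; rewrite // inE rq.
  - have [|r' r's r'x] := IH p; first by exists r; rewrite // inE rs orbT.
    by exists r'; rewrite // inE r's orbT.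
apply: IH; case/or3P: rpqs => [/eqP rp|/eqP rq|rs].
- exists (Num.min p.1 q.1, Num.max p.2 q.2); first by rewrite inE eqxx.
  by move: rx; rewrite rp /= gt_min le_max => /andP[-> ->].
- exists (Num.min p.1 q.1, Num.max p.2 q.2); first by rewrite inE eqxx.
  by move: rx; rewrite rq /= gt_min le_max => /andP[-> ->]; rewrite !orbT.
- by exists r; rewrite // inE rs orbT.
Qed.

(** Covers supplied by an outer measure may overlap, while [ac_family] controls only non-overlapping
    families. Merging costs no length, the hull of two overlapping intervals being no longer than
    both together. *)
Lemma nonoverlap_cover s : all (fun p => p.1 <= p.2) s ->
  exists s', [/\ all (fun p => p.1 <= p.2) s', pairwise nonoverlap s',
    \sum_(p <- s') (p.2 - p.1) <= \sum_(p <- s) (p.2 - p.1) &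
    forall x, (exists2 p, p \in s & p.1 < x <= p.2) ->
      exists2 p, p \in s' & p.1 < x <= p.2].
Proof.
elim: s => [|p s IH] /=; first by exists [::]; split => // [|x []//]; rewrite !big_nil.
move=> /andP[p12 /IH[s' [s'le s'no s'len s'cov]]].
exists (merge_in p s'); split.
- exact: merge_in_le.
- exact: merge_in_nonoverlap.
- by rewrite (le_trans (merge_in_length p12 s'le))// big_cons lerD2l.
- move=> x [r]; rewrite inE => /predU1P[->|rs] rx; apply: merge_in_cover.
    by exists p; rewrite // inE eqxx.
  have [|r' r's' r'x] := s'cov x; first by exists r.
  by exists r'; rewrite // inE r's' orbT.
Qed.

End merge.

(** * Absolute continuity of Stieltjes measures *)

Section stieltjes_dominated.
Context {R : realType}.
Local Notation mu := (@lebesgue_measure R).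

Lemma lebesgue_stieltjes_measure_ocitv (F : cumulative R R) (u v : R) :
  u <= v -> lebesgue_stieltjes_measure F `]u, v] = (F v - F u)%:E.
Proof.
move=> uv; rewrite /lebesgue_stieltjes_measure /measure_extension.
by rewrite measurable_mu_extE /=; [exact: wlength_itv_bnd|exact: is_ocitv].
Qed.

Lemma lebesgue_stieltjes_measure_cover (F : cumulative R R)
    (s : seq (R * R)) (A : set (measurableTypeR R)) :
  measurable A -> all (fun p => p.1 <= p.2) s ->
  (forall x, A x -> exists2 p, p \in s & p.1 < x <= p.2) ->
  (lebesgue_stieltjes_measure F A <= (\sum_(p <- s) (F p.2 - F p.1))%:E)%E.
Proof.
elim: s A => [|p s IH] A mA /=.
  move=> _ A0; rewrite big_nil; have -> : A = set0.
    by rewrite -subset0 => x /A0[].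
  by rewrite measure0.
move=> /andP[p12 s12] As; rewrite big_cons EFinD.
have mp : measurable (`]p.1, p.2]%classic : set (measurableTypeR R)).
  exact: measurable_itv.
rewrite -(setDUK (@subIsetl _ A `]p.1, p.2])) (le_trans (measureU2 _ _ _))//.
- exact: measurableI.
- by apply: measurableD => //; exact: measurableI.
apply: leeD.
  rewrite -lebesgue_stieltjes_measure_ocitv//.
  by apply: le_measure; rewrite ?inE//; exact: measurableI.
apply: IH => //; first by apply: measurableD => //; exact: measurableI.
move=> x [Ax Npx]; have [q] := As _ Ax; rewrite inE => /predU1P[->|qs] qx.
  by exfalso; apply: Npx; split => //=; rewrite in_itv.
by exists q.
Qed.

(** A null set has a countable cover by half-open intervals of total length below [d]. Finitely many
    of them, merged, form a non-overlapping family of length below [d], so their union has Stieltjes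
    measure at most [e]; continuity from below extends this to the whole cover. *)
Lemma ac_family_dominated (F : cumulative R R) : ac_family F ->
  lebesgue_stieltjes_measure F `<< mu.
Proof.
move=> acF; apply/null_content_dominatesP => A mA muA.
apply/eqP; rewrite eq_le measure_ge0 andbT; apply/lee_addgt0Pr => e e0.
rewrite add0e; have [d d0 dF] := acF _ e0.
have : (mu A < d%:E)%E by rewrite muA lte_fin.
move=> /ereal_inf_lt[_ [B [mB AB] <-] Bd].
have /choice[p pB] : forall i, exists p, p.1 <= p.2 /\ B i = `]p.1, p.2]%classic.
  move=> i; have /ocitvP[->|[[u v] /= uv ->]] := mB i.
    by exists (0, 0); split => //=; rewrite set_itvoc0.
  by exists (u, v); split => //; exact: ltW.
have mB' i : measurable (B i : set (measurableTypeR R)).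
  by rewrite (pB i).2; exact: measurable_itv.
have mU n : measurable (\big[setU/set0]_(i < n) B i : set (measurableTypeR R)).
  exact: bigsetU_measurable.
apply: (@le_trans _ _ (lebesgue_stieltjes_measure F (\bigcup_k B k))).
  by apply: le_measure; rewrite ?inE//; exact: bigcupT_measurable.
rewrite -bigcup_bigsetU_bigcup.
have cvgB := @nondecreasing_cvg_mu _ _ _ (lebesgue_stieltjes_measure F)
  (fun n => \big[setU/set0]_(i < n.+1) B i) (fun n => mU n.+1).
rewrite -(cvg_lim _ (cvgB _ _))//; last 2 first.
- by apply: bigcupT_measurable => n; exact: mU.
- by move=> m n mn; apply/subsetPset; exact: subset_bigsetU.
apply: lime_le.
  apply/cvg_ex; eexists; apply: cvgB.
    by apply: bigcupT_measurable => n; exact: mU.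
  by move=> m n mn; apply/subsetPset; exact: subset_bigsetU.
apply: nearW => n /=; pose s := [seq p i | i <- iota 0 n.+1].
have s_le : all (fun p => p.1 <= p.2) s.
  by apply/allP => _ /mapP[i _ ->]; exact: (pB i).1.
have [s' [s'_le s'_no s'_len s'_cov]] := nonoverlap_cover s_le.
have : (lebesgue_stieltjes_measure F (\big[setU/set0]_(i < n.+1) B i) <=
    (\sum_(p <- s') (F p.2 - F p.1))%:E)%E.
  apply: lebesgue_stieltjes_measure_cover => // x.
  rewrite -bigcup_mkord => -[i /= ni]; rewrite (pB i).2 /= in_itv /= => ix.
  apply: s'_cov; exists (p i) => //; apply/mapP; exists i => //.
  by rewrite mem_iota.
move/le_trans; apply; rewrite lee_fin ltW//.
apply: le_lt_trans (dF _ s'_le s'_no _).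
  by apply: ler_sum => i _; exact: ler_norm.
rewrite (le_lt_trans s'_len)// -lte_fin (le_lt_trans _ Bd)//.
apply: (@le_trans _ _ (\sum_(0 <= i < n.+1) wlength idfun (B i))%E); last first.
  by apply: nneseries_lim_ge => i _ _; exact: wlength_ge0.
rewrite -sumEFin big_map -[iota _ _]/(index_iota 0 n.+1).
apply: lee_sum => i _; rewrite (pB i).2 wlength_itv_bnd//; exact: (pB i).1.
Qed.

End stieltjes_dominated.

(** * Densities and almost everywhere derivatives *)

Section ac_density.
Context {R : realType}.
Local Notation mu := (@lebesgue_measure R).
Implicit Types F g : R -> R.

Lemma ac_family_continuous F : ac_family F -> continuous F.
Proof.
move=> acF x; apply/cvgrPdist_lt => e /acF[d d0 dF]; near=> y.
pose p := (Num.min x y, Num.max x y).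
have := dF [:: p]; rewrite /= !big_seq1 ge_min le_max lexx /=.
have -> : `|F (Num.max x y) - F (Num.min x y)| = `|F x - F y|.
  by rewrite /Num.max /Num.min; case: ifP => // _; rewrite distrC.
apply=> //; have : `|x - y| < d by near: y; exact: (nbhsx_ballx x d d0).
by rewrite ltr_distl maxEle minEle; case: ifPn; rewrite -?ltNge => *; lra.
Unshelve. all: by end_near. Qed.

(** Being constant outside [[0, b]], [F] has a Stieltjes measure of mass at most [F b - F 0]. This
    finiteness is what allows the Radon-Nikodym theorem to be applied. *)
Lemma ac_family_density_nondecreasing F (b : R) : 0 <= b ->
  {homo F : x y / x <= y} -> (forall t, F t = F (clip b t)) -> ac_family F ->
  exists2 g, mu.-integrable setT (EFin \o g) &
    forall x y, x <= y -> \int[mu]_(t in `]x, y]) g t = F y - F x.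
Proof.
move=> b0 ndF Fclip acF.
have rcF : right_continuous F by exact/right_continuousW/ac_family_continuous.
pose FC : cumulative R R := HB.pack F (isCumulative.Build R _ R F ndF rcF).
pose nu := lebesgue_stieltjes_measure FC.
have nuoo : (nu setT < +oo)%E.
  pose B (n : nat) : set (measurableTypeR R) := `]- n%:R, n%:R]%classic.
  have UB : \bigcup_n B n = setT.
    rewrite -subTset => x _; exists (Num.bound `|x|) => //=.
    have := archi_boundP (normr_ge0 x); rewrite ltr_norml => /andP[h1 h2].
    by rewrite /B /= in_itv /= h1 ltW.
  have mB n : measurable (B n) by exact: measurable_itv.
  have ndB : nondecreasing_seq B.
    move=> m n mn; apply/subsetPset => x; rewrite /B /= !in_itv /=.
    have : (m%:R : R) <= n%:R by rewrite ler_nat.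
    move=> h /andP[h1 h2]; apply/andP; split; lra.
  have mUB : measurable (\bigcup_n B n) by exact: bigcupT_measurable.
  have cB := @nondecreasing_cvg_mu _ _ _ nu B mB mUB ndB.
  have <- : limn (nu \o B) = nu setT.
    by rewrite -[in RHS]UB; apply/cvg_lim => //; exact: cB.
  apply: (@le_lt_trans _ _ (F b - F 0)%:E); last exact: ltry.
  apply: lime_le; first by apply/cvg_ex; eexists; exact: cB.
  apply: nearW => n /=; rewrite /nu lebesgue_stieltjes_measure_ocitv.
    rewrite lee_fin /= (Fclip n%:R) (Fclip (- n%:R)).
    have /andP[? ?] := clip_itv n%:R b0; have /andP[? ?] := clip_itv (- n%:R) b0.
    by apply: lerB; apply/ndF.
  by rewrite (@le_trans _ _ 0)// oppr_le0.
(* Restricting to the whole line changes no value; it bundles [nu] with its finiteness. *)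
pose nu' := mfrestr (@measurableT _ (measurableTypeR R)) nuoo.
have nu'E A : nu' A = nu A by rewrite /nu' /mfrestr /mrestr setIT.
have dom : nu' `<< mu.
  have /null_content_dominatesP d := @ac_family_dominated R FC acF.
  by apply/null_content_dominatesP => A mA muA; rewrite nu'E; exact: d.
have [h [h0 hfin hint hE]] := radon_nikodym_sigma_finite dom.
have hEF : h = EFin \o (fine \o h) by apply/funext => x /=; rewrite fineK.
exists (fine \o h); first by rewrite -hEF.
move=> x y xy; rewrite /Rintegral.
under eq_integral do rewrite -[(_)%:E]/((EFin \o (fine \o h)) _) -hEF.
rewrite -hE; last exact: measurable_itv.
by rewrite -[X in fine X]/(nu' _) nu'E /nu lebesgue_stieltjes_measure_ocitv.
Qed.

(** [F = V - (V - F)], where the variation function [V] grows at least as much as [F] moves, so that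
    both terms are nondecreasing; both are absolutely continuous and constant outside [[0, b]]. *)
Lemma ac_family_density F (b : R) : 0 <= b ->
  (forall t, F t = F (clip b t)) -> ac_family F ->
  exists2 g, mu.-integrable setT (EFin \o g) &
    forall x y, x <= y -> \int[mu]_(t in `]x, y]) g t = F y - F x.
Proof.
move=> b0 Fclip acF.
pose V := (fun t => fine (total_variation 0 t F)) \o clip b.
have acV : ac_family V by exact: ac_family_total_variation.
have clipK t : clip b (clip b t) = clip b t by rewrite clip_id// clip_itv.
have VB x y : x <= y ->
    V y - V x = fine (total_variation (clip b x) (clip b y) F).
  move=> xy; rewrite /V /= total_variationB//; first by case/andP: (clip_itv x b0).
  exact: clip_homo.
have VF x y : x <= y -> `|F y - F x| <= V y - V x.
  move=> xy; rewrite VB// (Fclip x) (Fclip y).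
  have cxy : clip b x <= clip b y by exact: clip_homo.
  rewrite -lee_fin fineK ?total_variation_ge//.
  by apply/bounded_variationP => //; exact: ac_family_bounded_variation.
have [g1 ig1 g1E] : exists2 g, mu.-integrable setT (EFin \o g) &
    forall x y, x <= y -> \int[mu]_(t in `]x, y]) g t = V y - V x.
  apply: (ac_family_density_nondecreasing b0) => //.
  - by move=> x y /VF h; rewrite -subr_ge0 (le_trans _ h).
  - by move=> t; rewrite /V /= clipK.
have [g2 ig2 g2E] : exists2 g, mu.-integrable setT (EFin \o g) &
    forall x y, x <= y -> \int[mu]_(t in `]x, y]) g t =
      (V y - F y) - (V x - F x).
  apply: (@ac_family_density_nondecreasing (fun t => V t - F t) b) => //.
  - by move=> x y /VF; have := ler_norm (F y - F x); lra.
  - by move=> t; rewrite /V /= clipK -Fclip.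
  - move=> e e0; have e20 : 0 < e / 2 by lra.
    have [d1 d10 h1] := acV _ e20; have [d2 d20 h2] := acF _ e20.
    exists (Num.min d1 d2); first by rewrite lt_min d10.
    move=> s s_le s_no; rewrite lt_min => /andP[s1 s2].
    rewrite [ltRHS]splitr (le_lt_trans _ (ltrD (h1 s _ _ _) (h2 s _ _ _)))//.
    rewrite -big_split /=; apply: ler_sum => p _.
    have E (u v w z : R) : u - v - (w - z) = (u - w) - (v - z) by ring.
    by rewrite E; exact: ler_normB.
exists (fun t => g1 t - g2 t); first exact: (integrableB _ ig1 ig2).
move=> x y xy; rewrite RintegralB//; last 2 first.
- exact: integrableS ig1.
- exact: integrableS ig2.
by rewrite g1E// g2E//; lra.
Qed.

(** [F] differs by a constant from the primitive of [g] taken from minus infinity, to which Lebesgue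
    differentiation applies. *)
Lemma density_derive F g : mu.-integrable setT (EFin \o g) ->
  (forall x y, x <= y -> \int[mu]_(t in `]x, y]) g t = F y - F x) ->
  {ae mu, forall x, derive1 F x = g x}.
Proof.
move=> ig gE.
have ig' y : mu.-integrable `]-oo, y] (EFin \o g) by exact: integrableS ig.
have lg : locally_integrable setT g.
  by apply: open_integrable_locally => //; exact: openT.
pose G y := \int[mu]_(t in `]-oo, y]) g t.
have GE x y : x <= y -> G y - G x = F y - F x.
  by move=> xy; rewrite -gE// /G Rintegral_itvB// bnd_simp.
have FG x : F x = G x + (F 0 - G 0).
  by case: (leP x 0) => [/GE|/ltW/GE] h; lra.
have FGf : F = G + cst (F 0 - G 0) by apply/funext.
have := FTC1Ny ig' lg; apply: filterS; first exact: (ae_filter_ringOfSetsType mu).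
move=> x [dG <-].
rewrite FGf derive1E deriveD; [|exact: dG|exact: derivable_cst].
by rewrite derive_cst addr0 -derive1E.
Qed.

Theorem absolutely_continuous_density F (b : R) : 0 <= b ->
  absolutely_continuous_on 0 b F ->
  exists g, [/\ mu.-integrable setT (EFin \o g),
    forall x y, 0 <= x -> x <= y -> y <= b ->
      \int[mu]_(t in `]x, y]) g t = F y - F x &
    {ae mu, forall x, 0 < x < b -> derive1 F x = g x}].
Proof.
move=> b0 acF.
have [||g ig gE] := @ac_family_density (F \o clip b) b b0.
- by move=> t; rewrite /= [clip b (clip b t)]clip_id// clip_itv.
- exact: ac_family_clip.
exists g; split => //.
  by move=> x y x0 xy yb; rewrite gE// /= !clip_id//; apply/andP; split; lra.
have := density_derive ig gE; apply: filterS; first exact: (ae_filter_ringOfSetsType mu).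
move=> x <- xb.
rewrite !derive1E; apply: near_eq_derive; near=> y.
rewrite /= clip_id//; have : y \in `]0, b[ by near: y; exact: near_in_itvoo.
by rewrite in_itv /= => /andP[/ltW -> /ltW ->].
Unshelve. all: by end_near. Qed.

End ac_density.

(** * Integrals on the half-line and condition (iii) *)

Section halfline.
Context {R : realType}.
Local Notation mu := (@lebesgue_measure R).
Implicit Types (F g h : R -> R) (a b s t : R).

Lemma near_clip t : \forall s \near t, clip (`|t| + 1) s = Num.max 0 s.
Proof.
near=> s; rewrite /clip (_ : Num.min s (`|t| + 1) = s)//; apply/min_idPl.
have : `|t - s| < 1 by near: s; exact: (nbhsx_ballx t 1 ltr01).
by have := ler_norm t; rewrite ltr_distl => h1 /andP[h2 h3]; lra.
Unshelve. all: by end_near. Qed.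

Lemma absolutely_continuous_continuous F :
  absolutely_continuous_halfline F -> continuous (fun t => F (Num.max 0 t)).
Proof.
move=> acF t; have b0 : 0 <= `|t| + 1 by rewrite addr_ge0.
have /(_ t) cF := ac_family_continuous (ac_family_clip b0 (acF _)).
rewrite /continuous_at -(nbhs_singleton (near_clip t)).
apply: cvg_trans cF; apply: near_eq_cvg; near=> s => /=; congr F.
by near: s; exact: near_clip.
Unshelve. all: by end_near. Qed.

Lemma continuous_integrable F a b : continuous F ->
  mu.-integrable `[a, b] (EFin \o F).
Proof.
move=> cF; apply: continuous_compact_integrable; first exact: segment_compact.
exact: continuous_subspaceT.
Qed.

(** The lower limit [-1] makes [0] an interior point, where the fundamental theorem of calculus then
    gives a two-sided derivative. *)
Definition primitive F (t : R) := \int[mu]_(u in `[-1, t]) F u.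

Lemma primitiveB F s t : continuous F -> -1 <= s -> s <= t ->
  primitive F t - primitive F s = \int[mu]_(u in `]s, t]) F u.
Proof.
move=> cF s1 st; rewrite /primitive Rintegral_itvB ?bnd_simp//.
exact: continuous_integrable.
Qed.

Lemma is_derive_primitive F t : continuous F -> -1 < t ->
  is_derive t 1 (primitive F) (F t).
Proof.
move=> cF t1; have tt1 : t < t + 1 by rewrite ltrDl.
have [d dE] := continuous_FTC1_closed tt1 (continuous_integrable _ _ cF) t1 (cF t).
by split; [exact: d|rewrite -derive1E; exact: dE].
Qed.

(** Monotone convergence along [[0, n]]; passing from [n] to a larger real and from [0] to [-1] only
    enlarges the domain of a nonnegative integrand. *)
Lemma primitive_cvgy F : continuous F -> (forall t, 0 <= F t) ->
  (\int[mu]_(t in `[0%R, +oo[) (F t)%:E = +oo)%E ->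
  primitive F t @[t --> +oo] --> +oo.
Proof.
move=> cF F0 Foo.
have mF (D : set R) : measurable_fun D (fun t => (F t)%:E).
  by apply/measurable_EFinP/measurable_funTS; exact: continuous_measurable_fun.
have : (\int[mu]_(t in `[0%R, n%:R]) (F t)%:E)%E @[n --> \oo] --> +oo%E.
  rewrite -Foo -[`[0, +oo[%classic](_ : \bigcup_n `[0, n%:R]%classic = _).
    apply: ge0_nondecreasing_set_cvg_integral => //.
    - move=> m n mn; apply/subsetPset => x /=; rewrite !in_itv /= => /andP[-> h].
      by rewrite (le_trans h)// ler_nat.
    - by move=> n; exact: mF.
    - by move=> n x _; rewrite lee_fin.
  apply/seteqP; split => x /=.
    by move=> [n _] /=; rewrite !in_itv /= => /andP[->].
  rewrite in_itv /= andbT => x0; exists (Num.bound x) => //=.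
  by rewrite in_itv /= x0 ltW// archi_boundP.
move=> /cvgeyPge coo; apply/cvgryPge => M.
have [n _ /(_ n (leqnn n)) /= Mn] := coo M; near=> t.
have nt : n%:R <= t by near: t; exact: nbhs_pinfty_ge.
have n0 : (0 : R) <= n%:R by [].
rewrite -lee_fin (le_trans Mn)// /primitive /Rintegral fineK; last first.
  by apply: integrable_fin_num => //; exact: continuous_integrable.
apply: ge0_subset_integral => //; first exact: mF.
  by move=> x _; rewrite lee_fin.
by move=> x /=; rewrite !in_itv /= => /andP[? ?]; apply/andP; split; lra.
Unshelve. all: by end_near. Qed.

(* The integral of a non-negative non-measurable function is its lower
   integral, so [f] need not be measurable. *)
Lemma ae_eq_integral_le (D E : set (measurableTypeR R)) (h f : R -> \bar R) :
  measurable D -> D `<=` E -> measurable_fun D h ->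
  (forall x, D x -> 0 <= h x)%E -> (forall x, 0 <= f x)%E ->
  {ae mu, forall x, D x -> f x = h x} ->
  (\int[mu]_(x in D) h x <= \int[mu]_(x in E) f x)%E.
Proof.
move=> mD DE mh h0 f0 [N [mN muN hN]].
rewrite (ge0_negligible_integral mN mD mh h0 muN).
rewrite ge0_integralE; last by move=> x [/h0].
rewrite ge0_integralE//; apply: ge_ereal_sup => _ [k /= kh <-].
apply: ereal_sup_ubound; exists k => //= x; apply: le_trans (kh x) _.
rewrite !patchE; case: ifPn => [|_]; last by case: ifP.
rewrite inE => -[Dx Nx]; rewrite mem_set; last exact: DE.
have -> // : h x = f x.
by apply/esym; apply: contrapT => fh; apply: Nx; apply: hN => /= /(_ Dx).
Qed.

(** [W t] is the total variation of [F] on [[0, t]]. Increments over a partition are integrals of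
    the density [g], so their absolute values sum to at most the integral of [|g|], and [g] is
    almost everywhere the derivative. *)
Lemma absolutely_continuous_variation F (K : R) :
  absolutely_continuous_halfline F ->
  (\int[mu]_(t in `[0%R, +oo[) `|derive1 F t|%:E <= K%:E)%E ->
  exists W : R -> R, [/\ forall t, 0 < t -> {for t, continuous W},
    forall t, 0 <= t -> W t <= K &
    forall s t, 0 <= s -> s <= t -> `|F t - F s| <= W t - W s].
Proof.
move=> acF FK.
have var_le b : 0 <= b -> (total_variation 0 b F <= K%:E)%E.
  move=> b0; have [g [ig gE gF]] := absolutely_continuous_density b0 (acF b).
  have iab (D : set (measurableTypeR R)) : measurable D ->
      mu.-integrable D (EFin \o (fun t => `|g t|)).
    by move=> mD; apply: (integrableS measurableT mD (@subsetT _ _));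
      exact: integrable_abse ig.
  apply: ge_ereal_sup => _ [_ [l [pl /eqP lb] <-] <-].
  rewrite -gaps_variation.
  have sum_le a l' : 0 <= a -> path <%R a l' -> last a l' <= b ->
      \sum_(p <- gaps a l') `|F p.2 - F p.1| <=
      \int[mu]_(t in `]a, last a l']) `|g t|.
    elim: l' a => [|x l' IH] a a0; first by rewrite big_nil set_itvoc0 Rintegral_set0.
    move=> /= /andP[ax xl] lb'; rewrite gaps_cons big_cons.
    have xlast := path_le_last xl.
    rewrite (@itv_bndbnd_setU _ _ _ (BRight x)) ?bnd_simp//; last exact: ltW.
    rewrite Rintegral_setU//; last 2 first.
    - by apply: iab; exact: measurableU.
    - apply/disj_setPRL => y /=; rewrite !in_itv /= => /andP[xy _].
      by apply/negP; rewrite negb_and -ltNge xy orbT.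
    apply: lerD; last by apply: IH => //; rewrite (le_trans a0)// ltW.
    rewrite /= -gE//; [|exact: ltW|exact: le_trans xlast lb'].
    by apply: le_normr_Rintegral => //; apply: integrableS ig.
  apply: (@le_trans _ _ (\int[mu]_(t in `]0%R, b]) `|g t|%:E)%E).
    rewrite -[leRHS]fineK; last exact: (integrable_fin_num _ (iab _ _)).
    by rewrite lee_fin -/(Rintegral _ _ _) -[in leRHS]lb; apply: sum_le; rewrite ?lb.
  (* The right end is dropped because [g] is identified with the derivative only inside []0, b[]. *)
  rewrite -integral_itv_bndo_bndc; last first.
    by apply: (measurable_int mu); apply: iab; exact: measurable_itv.
  apply: le_trans FK; apply: ae_eq_integral_le => //.
  - by move=> x /=; rewrite !in_itv /= andbT => /andP[/ltW].
  - by apply: (measurable_int mu); apply: iab; exact: measurable_itv.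
  - move: gF; apply: filterS; first exact: (ae_filter_ringOfSetsType mu).
    by move=> x /= + xb; move=> ->//; move: xb; rewrite in_itv.
have fin b : 0 <= b -> total_variation 0 b F \is a fin_num.
  move=> b0; rewrite ge0_fin_numE ?total_variation_ge0//.
  by rewrite (le_lt_trans (var_le _ b0))// ltry.
exists (fun t => fine (total_variation 0 t F)); split.
- move=> t t0; have b0 : 0 < t + 1 by lra.
  have bv : bounded_variation 0 (t + 1) F.
    by apply/bounded_variationP; [exact: ltW|apply: fin; exact: ltW].
  have cF : {within `[0, t + 1], continuous F}.
    apply: (@subspace_eq_continuous _ _ _ (fun t => F (Num.max 0 t))).
      by move=> x; rewrite inE /= in_itv /= => /andP[x0 _]; rewrite max_r.
    exact/continuous_subspaceT/absolutely_continuous_continuous.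
  have := total_variation_continuous b0 cF bv.
  by move=> /(continuous_within_itvP _ b0)[+ _ _]; apply; rewrite in_itv /= t0; lra.
- by move=> t t0; rewrite -lee_fin fineK ?fin// var_le.
- move=> s t s0 st; have t0 := le_trans s0 st.
  have := fin _ t0; rewrite (total_variationD F s0 st) fin_numD => /andP[_ fst].
  rewrite fineD ?fin// addrAC subrr add0r -lee_fin fineK//.
  exact: total_variation_ge.
Qed.

(** Beyond some time and off a null set [|derive1 F| <= e F]; the density of [F] obeys the same
    bound almost everywhere and is integrated. *)
Lemma absolutely_continuous_ratio F (e : R) :
  (forall t, 0 <= t -> 0 < F t) -> absolutely_continuous_halfline F -> 0 < e ->
  ae_cvg_pinfty (fun t => derive1 F t / F t) 0 ->
  exists2 A, 0 < A & forall s t, A <= s -> s <= t ->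
    `|F t - F s| <= e * (primitive (fun t => F (Num.max 0 t)) t -
                         primitive (fun t => F (Num.max 0 t)) s).
Proof.
move=> F0 acF e0 [N [N' [mN' muN' NN']]].
move=> /cvgr0Pnorm_lt /(_ _ e0) [A0 [_ hA0]].
pose A := Num.max 1 A0; exists A; first by rewrite lt_max ltr01.
move=> s t As st.
have A1 : 1 <= A by rewrite le_max lexx.
have s0 : 0 <= s by lra.
(* One unit beyond [t], so that all of []s, t]] is interior to the interval on which the density is
   taken. *)
have t0 : 0 <= t + 1 by lra.
have [g [ig gE gF]] := absolutely_continuous_density t0 (acF (t + 1)).
have cF := absolutely_continuous_continuous acF.
have igD (D : set R) : measurable D -> mu.-integrable D (EFin \o g).
  by move=> mD; exact: integrableS ig.
have iF : mu.-integrable `]s, t] (EFin \o (fun t => F (Num.max 0 t))).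
  apply: (@integrableS _ _ _ mu `[s, t]) => //.
    by move=> x /=; rewrite !in_itv /= => /andP[/ltW -> ->].
  exact: continuous_integrable.
rewrite primitiveB//; last lra.
rewrite -gE//; last lra.
rewrite -RintegralZl// (le_trans (le_normr_Rintegral _ (igD _ _)))//.
have ieF : mu.-integrable `]s, t] (EFin \o (fun t => e * F (Num.max 0 t))).
  exact: (integrableZl _ e iF).
have iag : mu.-integrable `]s, t] (EFin \o (fun t => `|g t|)).
  by have := integrable_abse (igD `]s, t]%classic (measurable_itv _)).
apply: fine_le; [exact: integrable_fin_num iag|exact: integrable_fin_num ieF|].
apply: ae_ge0_le_integral => //.
- exact: measurable_int iag.
- move=> x; rewrite /= in_itv /= => /andP[sx _].
  by rewrite lee_fin mulr_ge0 ?ltW// F0// le_max lexx.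
- exact: measurable_int ieF.
have : {ae mu, forall x, ~ N x} by exists N'; split => // x /= /contrapT /NN'.
move: gF; apply: filterS2; first exact: (ae_filter_ringOfSetsType mu).
move=> x gx Nx; rewrite /= in_itv /= => /andP[sx xt].
have x0 : 0 < x by lra.
rewrite lee_fin -gx; last by apply/andP; split; lra.
rewrite max_r; last exact: ltW.
have A0x : A0 < x by rewrite (le_lt_trans _ sx)// (le_trans _ As)// le_max lexx orbT.
have Fx0 : 0 < F x by apply: F0; exact: ltW.
have := hA0 x A0x Nx; rewrite /= normrM normfV (gtr0_norm Fx0) => /ltW.
by rewrite ler_pdivrMr.
Qed.

End halfline.

Section small_variation.
Context {R : realType}.
Local Notation mu := (@lebesgue_measure R).

(** If [F' / F] vanishes at infinity, [W = 0] will do. If [F'] is integrable, [W] is the variation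
    accumulated since [A], and the nonnegative term in [e] is simply added. *)
Lemma eventually_small_variation (F : R -> R) (e : R) :
  (forall t, 0 <= t -> 0 < F t) -> absolutely_continuous_halfline F -> 0 < e ->
  (\int[mu]_(t in `[0%R, +oo[) `|derive1 F t|%:E < +oo)%E \/
    ae_cvg_pinfty (fun t => derive1 F t / F t) 0 ->
  exists (A : R) (W : R -> R), [/\ 0 < A, forall t, A <= t -> {for t, continuous W},
    forall t, A <= t -> 0 <= W t <= e &
    forall s t, A <= s -> s <= t -> `|F t - F s| <= W t - W s +
      e * (primitive (fun t => F (Num.max 0 t)) t -
           primitive (fun t => F (Num.max 0 t)) s)].
Proof.
move=> F0 acF e0 [Foo|Fratio]; last first.
  have [A A0 hA] := absolutely_continuous_ratio F0 acF e0 Fratio.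
  exists A, (cst 0); split => //.
  - by move=> t _; exact: cvg_cst.
  - by move=> t _; rewrite lexx ltW.
  - by move=> s t As st; rewrite subrr add0r hA.
set I := (\int[mu]_(t in _) _)%E in Foo.
have I0 : (0 <= I)%E by apply: integral_ge0.
have [|W [cW WK VW]] := @absolutely_continuous_variation R F (fine I) acF.
  by rewrite -/I fineK ?ge0_fin_numE.
have ndW s t : 0 <= s -> s <= t -> W s <= W t.
  by move=> s0 /(VW _ _ s0) h; rewrite -subr_ge0 (le_trans _ h).
pose S := [set W t | t in [set t | 1 <= t]].
have supS : has_sup S.
  split; first by exists (W 1), 1 => /=.
  by exists (fine I) => _ [t /= t1 <-]; apply: WK; rewrite (le_trans ler01).
(* Past [A], at most [e] of the bounded total variation remains. *)
have [_ [A /= A1 <-] hA] := sup_adherent e0 supS.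
have A0 : 0 < A by rewrite (lt_le_trans ltr01).
have cF := absolutely_continuous_continuous acF.
exists A, (fun t => W t - W A); split => //.
- move=> t At; apply: cvgB; last exact: cvg_cst.
  by apply: cW; rewrite (lt_le_trans A0).
- move=> t At; rewrite subr_ge0 ndW ?(ltW A0)//=.
  have : W t <= sup S.
    by apply: ub_le_sup; [exact: supS.2|exists t => //=; exact: le_trans At].
  lra.
- move=> s t As st; have s0 : 0 <= s by rewrite ltW// (lt_le_trans A0).
  rewrite opprB addrA subrK (le_trans (VW _ _ s0 st))// lerDl mulr_ge0 ?(ltW e0)//.
  rewrite primitiveB//; last by rewrite (le_trans _ s0)// lerN10.
  by apply: Rintegral_ge0 => x _; rewrite ltW// F0// le_max lexx.
Qed.

End small_variation.

(** * Inequalities for right derivatives *)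

Section right_derivatives.
Context {R : realType}.
Implicit Types (phi f : R -> R) (a b t : R).

(** Let [c] be the supremum of the points of [[a, b]] where [phi t <= phi a + e (t - a)]. Continuity
    puts [c] in that set, and if [c < b] the right-hand estimate at [c] leads past [c]. The last
    hypothesis says that the upper right Dini derivative is nowhere positive. *)
Lemma right_locally_nonincreasing phi a b : a <= b ->
  (forall t, a <= t <= b -> {for t, continuous phi}) ->
  (forall t, a <= t < b -> forall e, 0 < e ->
    \forall s \near t^'+, phi s - phi t <= e * (s - t)) ->
  phi b <= phi a.
Proof.
move=> ab cphi dphi; apply/ler_addgt0Pr => e' e'0.
(* The [+ 1] covers the case [a = b]. *)
pose e := e' / (b - a + 1).
have ba1 : 0 < b - a + 1 by rewrite ltr_wpDl// subr_ge0.
have e0 : 0 < e by rewrite divr_gt0.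
pose S := [set t | [/\ a <= t, t <= b & phi t <= phi a + e * (t - a)]].
have Sa : S a by split => //; rewrite subrr mulr0 addr0.
have supS : has_sup S by split; [exists a|exists b => t []].
pose c := sup S.
have ac : a <= c by apply: ub_le_sup => //; exact: supS.2.
have cb : c <= b by apply: ge_sup; [exists a|move=> t []].
have Sc : S c.
  split => //; rewrite leNgt; apply/negP => hc.
  have cc : {for c, continuous (fun t => phi t - e * (t - a))}.
    apply: cvgB; first by apply: cphi; rewrite ac.
    by apply: cvgM; [exact: cvg_cst|apply: cvgB; [exact: cvg_id|exact: cvg_cst]].
  have hc' : phi a < phi c - e * (c - a) by lra.
  have [d /= d0 hd] := cvgr_gt _ cc _ hc'.
  have [t [at' tb St] ct] := sup_adherent d0 supS.
  have tc : t <= c by apply: ub_le_sup; [exact: supS.2|split].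
  have /hd /= : ball c d t by rewrite /ball /= ger0_norm; rewrite -/c in ct; lra.
  lra.
case: (ltP c b) => [clt|bc]; last first.
  have -> : b = c by apply/eqP; rewrite eq_le bc cb.
  have [_ _ h] := Sc; apply: (le_trans h); rewrite lerD2l.
  rewrite /e -mulrA ler_piMr// ?(ltW e'0)// mulrC ler_pdivrMr//; lra.
exfalso.
have acb : a <= c < b by rewrite ac clt.
have /filter_ex[s [Ss]] : \forall s \near c^'+, S s /\ c < s.
  near=> s.
  have cs : c < s by near: s; exact: nbhs_right_gt.
  have sb : s < b by near: s; exact: nbhs_right_lt.
  have h : phi s - phi c <= e * (s - c) by near: s; exact: dphi.
  by have [_ _ h'] := Sc; split => //; split; lra.
by rewrite ltNge ub_le_sup//; exact: supS.2.
Unshelve. all: by end_near. Qed.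

Lemma is_derive_right_near f t (df e : R) : is_derive t 1 f df -> 0 < e ->
  \forall s \near t^'+, `|f s - f t - (s - t) * df| <= e * (s - t).
Proof.
move=> dfE e0; have [dft <-] := dfE.
have /cvgrPdist_le/(_ _ e0)[d /= d0 hd] := dft; rewrite -/('D_1 f t) in hd.
near=> s; have ts : t < s by near: s; exact: nbhs_right_gt.
have st0 : 0 < s - t by lra.
have : `|'D_1 f t - (s - t)^-1 *: (f ((s - t) *: 1 + t) - f t)| <= e.
  apply: hd; last by rewrite gt_eqF.
  rewrite /= sub0r normrN gtr0_norm//.
  have : s < t + d by near: s; apply: nbhs_right_lt; rewrite ltrDl.
  lra.
rewrite [(s - t) *: 1]mulr1 subrK => h.
have -> : f s - f t - (s - t) * 'D_1 f t =
    - (s - t) * ('D_1 f t - (s - t)^-1 * (f s - f t)).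
  by field; rewrite gt_eqF.
by rewrite normrM normrN (gtr0_norm st0) [leRHS]mulrC ler_wpM2l// ltW.
Unshelve. all: by end_near. Qed.

(* Differential Gronwall inequality for [phi' <= k theta (m - phi)]: the
   function [expR (k Theta) * (phi - m)] is nonincreasing. *)
Lemma gronwall (theta Theta phi : R -> R) (k m : R) a b : a <= b ->
  (forall t, a <= t <= b -> is_derive t 1 Theta (theta t)) ->
  (forall t, a <= t <= b -> {for t, continuous phi}) ->
  (forall t, a <= t < b -> forall e, 0 < e -> \forall s \near t^'+,
    phi s - phi t <= (s - t) * (k * theta t * (m - phi t) + e)) ->
  phi b - m <= expR (- (k * (Theta b - Theta a))) * (phi a - m).
Proof.
move=> ab dTheta cphi dphi.
pose E t := expR (k * Theta t).
have dE t : a <= t <= b -> is_derive t 1 E (k * theta t * E t).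
  move=> tab; have dT := dTheta _ tab.
  have -> : E = expR \o (fun t => k * Theta t) by [].
  by apply: is_derive_eq; rewrite /GRing.scale /= /E; ring.
have cE t : a <= t <= b -> {for t, continuous E}.
  by move=> /dE [dEt _]; apply/differentiable_continuous/derivable1_diffP.
have : E b * (phi b - m) <= E a * (phi a - m).
  apply: (@right_locally_nonincreasing (fun t => E t * (phi t - m))) => //.
    move=> t tab; apply: cvgM; first exact: cE.
    by apply: cvgB; [exact: cphi|exact: cvg_cst].
  move=> t tab e e0.
  have tab' : a <= t <= b by case/andP: tab => -> /ltW.
  (* [Q] bounds every factor met below, including [E s] because [d <= 1]; three errors, each at most
     [(s - t) * (d * Q)], then share [e]. *)
  pose Q := `|k * theta t * (m - phi t)| + `|phi t - m| + E t + 1.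
  have Et0 : 0 < E t by exact: expR_gt0.
  have := normr_ge0 (phi t - m); have := normr_ge0 (k * theta t * (m - phi t)).
  move=> n1 n2; have Q0 : 0 < Q by rewrite /Q; lra.
  pose d := Num.min 1 (e / (3 * Q)).
  have d1 : d <= 1 by rewrite ge_min lexx.
  have d0 : 0 < d by rewrite lt_min ltr01 divr_gt0// mulr_gt0.
  have dQ : 3 * (d * Q) <= e.
    have : d <= e / (3 * Q) by rewrite ge_min lexx orbT.
    by rewrite ler_pdivlMr ?mulr_gt0//; lra.
  near=> s.
  have ts : t < s by near: s; exact: nbhs_right_gt.
  have h1 : phi s - phi t <= (s - t) * (k * theta t * (m - phi t) + d).
    by near: s; exact: dphi.
  have h2 : `|E s - E t - (s - t) * (k * theta t * E t)| <= d * (s - t).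
    by near: s; apply: is_derive_right_near => //; exact: dE.
  have h3 : `|E t - E s| <= d.
    by near: s; apply: cvgr_dist_le d0; apply: cvg_at_right_filter; exact: cE.
  have Es0 : 0 <= E s by exact: expR_ge0.
  have st0 : 0 <= s - t by lra.
  have EQ : E s <= Q by move: h3; rewrite ler_distl /Q; lra.
  (* Product rule for increments: the first-order terms in [k theta E (m - phi)] and
     [k theta E (phi - m)] cancel. *)
  have -> : E s * (phi s - m) - E t * (phi t - m) =
    E s * (phi s - phi t) + (phi t - m) * (E s - E t) by ring.
  have l1 : E s * (phi s - phi t) <=
      E s * ((s - t) * (k * theta t * (m - phi t) + d)) by exact: ler_wpM2l.
  have l2 : (phi t - m) * (E s - E t - (s - t) * (k * theta t * E t)) <=
      Q * (d * (s - t)).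
    apply: le_trans (ler_norm _) _; rewrite normrM ler_pM//.
    by rewrite /Q; lra.
  have l3 : (E s - E t) * (k * theta t * (m - phi t)) <= d * Q.
    apply: le_trans (ler_norm _) _; rewrite normrM ler_pM// ?(distrC (E s))//.
    by rewrite /Q; lra.
  have l4 : (s - t) * ((E s - E t) * (k * theta t * (m - phi t))) <=
    (s - t) * (d * Q) by exact: ler_wpM2l.
  have l5 : E s * ((s - t) * d) <= Q * ((s - t) * d).
    by apply: ler_wpM2r => //; rewrite mulr_ge0// ltW.
  have l6 : (s - t) * (3 * (d * Q)) <= (s - t) * e by exact: ler_wpM2l.
  lra.
rewrite -ler_pdivlMl ?expR_gt0// mulrA -expRN -expRD => h.
by apply: le_trans h _; rewrite le_eqVlt; apply/orP; left; apply/eqP;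
  congr (expR _ * _); ring.
Unshelve. all: by end_near. Qed.

End right_derivatives.

(** * Existence and uniqueness of trajectories *)

(* Only the values of [f] and [T] on [C] matter; [1 - c] is the contraction
   coefficient of [f]. *)
Record viscosity_system (R : realType) (H : completeNormedModType R)
    (C : set H) (f T : H -> H) (theta : R -> R) (c : R) : Prop := {
  vs_closed : closed C ;
  vs_convex : forall x y (k : R), C x -> C y -> 0 <= k <= 1 ->
    C ((1 - k) *: x + k *: y) ;
  vs_f : forall x, C x -> C (f x) ;
  vs_T : forall x, C x -> C (T x) ;
  vs_contr : forall x y, C x -> C y -> `|f x - f y| <= (1 - c) * `|x - y| ;
  vs_nonexp : forall x y, C x -> C y -> `|T x - T y| <= `|x - y| ;
  vs_c : 0 < c <= 1 ;
  vs_theta : forall t, 0 < theta t <= 1 ;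
  vs_theta_cont : continuous theta ;
  vs_theta_unif : forall b e, 0 < e -> exists2 d, 0 < d &
    forall s t, 0 <= s -> s <= t -> t <= b -> t - s < d ->
      `|theta t - theta s| < e }.

(** * The vector field and its Euler step *)

Section viscosity_field.
Context {R : realType} {H : completeNormedModType R} {C : set H}
  {f T : H -> H} {theta : R -> R} {c : R}.
Hypothesis sys : viscosity_system C f T theta c.
Implicit Types (x y z : H) (t s k : R).

Definition visc (f T : H -> H) (theta : R -> R) (t : R) (z : H) :=
  theta t *: f z + (1 - theta t) *: T z.

Definition field (f T : H -> H) (theta : R -> R) (t : R) (z : H) :=
  visc f T theta t z - z.

Local Notation F := (visc f T theta).
Local Notation G := (field f T theta).

Lemma visc_in t z : C z -> C (F t z).
Proof.
move=> Cz; have /andP[t0 t1] := vs_theta sys t; rewrite /visc addrC.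
by apply: (vs_convex sys); [exact: (vs_T sys)|exact: (vs_f sys)|rewrite ltW].
Qed.

Lemma visc_contr t x y : C x -> C y ->
  `|F t x - F t y| <= (1 - c * theta t) * `|x - y|.
Proof.
move=> Cx Cy; have /andP[t0 t1] := vs_theta sys t.
have -> : F t x - F t y = theta t *: (f x - f y) + (1 - theta t) *: (T x - T y).
  by rewrite /visc !scalerBr opprD addrACA.
apply: le_trans (ler_normD _ _) _; rewrite !normrZ (gtr0_norm t0).
rewrite ger0_norm ?subr_ge0//.
have := ler_wpM2l (ltW t0) (vs_contr sys Cx Cy).
have := ler_wpM2l (_ : 0 <= 1 - theta t) (vs_nonexp sys Cx Cy).
by rewrite subr_ge0 => /(_ t1); lra.
Qed.

Lemma visc_nonexp t x y : C x -> C y -> `|F t x - F t y| <= `|x - y|.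
Proof.
move=> Cx Cy; apply: le_trans (visc_contr t Cx Cy) _.
have /andP[t0 t1] := vs_theta sys t; have /andP[c0 c1] := vs_c sys.
by rewrite ler_piMl// gerBl mulr_ge0// ltW.
Qed.

Lemma viscE t z : F t z = T z + theta t *: (f z - T z).
Proof. by rewrite /visc scalerBr scalerBl scale1r addrCA. Qed.

Lemma visc_time s t z : F s z - F t z = (theta s - theta t) *: (f z - T z).
Proof. by rewrite !viscE opprD addrACA subrr add0r -scalerBl. Qed.

Lemma field_lip t x y : C x -> C y -> `|G t x - G t y| <= 2 * `|x - y|.
Proof.
move=> Cx Cy; have -> : G t x - G t y = (F t x - F t y) - (x - y).
  by rewrite /field opprD addrACA -opprD.
apply: le_trans (ler_normB _ _) _; have := visc_nonexp t Cx Cy; lra.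
Qed.

Lemma field_time s t z : G s z - G t z = (theta s - theta t) *: (f z - T z).
Proof. by rewrite -visc_time /field opprB addrA subrK. Qed.

(** As a convex combination of [z] and [F t z], the Euler step stays in [C] and is Lipschitz with
    constant [(1 - k) + k (1 - c theta t)]. *)
Lemma stepE t k z : z + k *: G t z = (1 - k) *: z + k *: F t z.
Proof. by rewrite /field scalerBr scalerBl scale1r addrCA addrC. Qed.

Lemma step_in t k z : C z -> 0 <= k <= 1 -> C (z + k *: G t z).
Proof.
move=> Cz k01; rewrite stepE.
by apply: (vs_convex sys) => //; exact: visc_in.
Qed.

Lemma step_contr t k x y : C x -> C y -> 0 <= k <= 1 ->
  `|(x + k *: G t x) - (y + k *: G t y)| <= (1 - k * (c * theta t)) * `|x - y|.
Proof.
move=> Cx Cy /andP[k0 k1].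
have -> : (x + k *: G t x) - (y + k *: G t y) =
    (1 - k) *: (x - y) + k *: (F t x - F t y).
  by rewrite !stepE opprD addrACA -!scalerBr.
apply: le_trans (ler_normD _ _) _; rewrite !normrZ ger0_norm ?subr_ge0//.
rewrite (ger0_norm k0); have := ler_wpM2l k0 (visc_contr t Cx Cy); lra.
Qed.

Lemma step_nonexp t k x y : C x -> C y -> 0 <= k <= 1 ->
  `|(x + k *: G t x) - (y + k *: G t y)| <= `|x - y|.
Proof.
move=> Cx Cy k01; apply: le_trans (step_contr t Cx Cy k01) _.
have /andP[t0 t1] := vs_theta sys t; have /andP[c0 c1] := vs_c sys.
have /andP[k0 _] := k01.
by rewrite ler_piMl// gerBl mulr_ge0// mulr_ge0// ltW.
Qed.

End viscosity_field.

(** * Approximate solutions and Euler polygons *)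

Section approximate_solutions.
Context {R : realType} {H : completeNormedModType R} {C : set H}
  {f T : H -> H} {theta : R -> R} {c : R}.
Hypothesis sys : viscosity_system C f T theta c.
Implicit Types (x y : R -> H) (z p : H) (t s a b h e : R).

Local Notation F := (visc f T theta).
Local Notation G := (field f T theta).

(* Only a right-sided one-step estimate is required, so that the polygons of
   Euler's method qualify. *)
Definition approx_sol e b x := [/\ continuous x,
  forall t, 0 <= t <= b -> C (x t) &
  forall t, 0 <= t < b -> \forall s \near t^'+,
    `|x s - (x t + (s - t) *: G t (x t))| <= e * (s - t)].

Lemma approx_sol_le e e' b b' x : e <= e' -> b' <= b ->
  approx_sol e b x -> approx_sol e' b' x.
Proof.
move=> ee' b'b [cx Cx dx]; split => //.
  by move=> t /andP[t0 tb]; apply: Cx; rewrite t0 (le_trans tb).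
move=> t /andP[t0 tb]; have tb' : 0 <= t < b by rewrite t0 (lt_le_trans tb).
near=> s; have ts : t < s by near: s; exact: nbhs_right_gt.
apply: (@le_trans _ _ (e * (s - t))); first by near: s; exact: dx.
by rewrite ler_wpM2r// subr_ge0 ltW.
Unshelve. all: by end_near. Qed.

Lemma near_right_short t h : 0 < h -> \forall s \near t^'+, 0 < s - t <= h.
Proof.
move=> h0; near=> s.
have ts : t < s by near: s; exact: nbhs_right_gt.
have : s < t + h by near: s; apply: nbhs_right_lt; rewrite ltrDl.
by move=> sth; apply/andP; split; lra.
Unshelve. all: by end_near. Qed.

(** Each function stays close to an Euler step, and that step is nonexpansive, so the distance grows
    at rate at most [e1 + e2]. The Lipschitz constant 2 of the field alone would give exponential
    growth. *)
Lemma approx_sol_dist e1 e2 b x y t :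
  approx_sol e1 b x -> approx_sol e2 b y -> 0 <= t <= b ->
  `|x t - y t| <= `|x 0 - y 0| + (e1 + e2) * t.
Proof.
move=> [cx Cx dx] [cy Cy dy] /andP[t0 tb].
have : `|x t - y t| - (e1 + e2) * t <= `|x 0 - y 0| - (e1 + e2) * 0.
  apply: (@right_locally_nonincreasing _
    (fun u => `|x u - y u| - (e1 + e2) * u)) => //.
    move=> u _; apply: cvgB.
      by apply: cvg_norm; apply: cvgB; [exact: cx|exact: cy].
    by apply: cvgM; [exact: cvg_cst|exact: cvg_id].
  move=> u /andP[u0 ut] e e0.
  have ub : 0 <= u < b by rewrite u0 (lt_le_trans ut).
  have ub' : 0 <= u <= b by rewrite u0 ltW// (lt_le_trans ut).
  near=> s.
  have /andP[su su1] : 0 < s - u <= 1 by near: s; exact: near_right_short.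
  have hx : `|x s - (x u + (s - u) *: G u (x u))| <= e1 * (s - u).
    by near: s; exact: dx.
  have hy : `|y s - (y u + (s - u) *: G u (y u))| <= e2 * (s - u).
    by near: s; exact: dy.
  have su01 : 0 <= s - u <= 1 by rewrite ltW.
  have hxy := step_nonexp sys u (Cx _ ub') (Cy _ ub') su01.
  have := ler_distD (x u + (s - u) *: G u (x u)) (x s) (y s).
  have := ler_distD (y u + (s - u) *: G u (y u))
    (x u + (s - u) *: G u (x u)) (y s).
  rewrite [X in _ <= _ + X -> _]distrC => h1 h2.
  have : 0 <= e * (s - u) by rewrite mulr_ge0// ltW.
  lra.
lra.
Unshelve. all: by end_near. Qed.

Lemma field_fix t p : T p = p -> G t p = theta t *: (f p - p).
Proof. by move=> Tp; rewrite /field viscE Tp addrAC subrr add0r. Qed.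

(** At a fixed point of [T] the field reduces to [theta (f p - p)], so the constant [p] has bounded
    defect. Comparison with it bounds approximate solutions in advance. *)
Lemma approx_sol_fix b p : C p -> T p = p -> approx_sol `|f p - p| b (cst p).
Proof.
move=> Cp Tp; split => //; first by move=> ?; exact: cvg_cst.
move=> t _; near=> s; have st : 0 <= s - t.
  by rewrite subr_ge0 ltW//; near: s; exact: nbhs_right_gt.
have /andP[t0 t1] := vs_theta sys t.
rewrite /= opprD addrA subrr add0r normrN normrZ (ger0_norm st) mulrC.
by rewrite ler_wpM2r// field_fix// normrZ (gtr0_norm t0) ler_piMl.
Unshelve. all: by end_near. Qed.

Lemma approx_sol_extend e a h x : 0 <= a -> 0 < h <= 1 -> approx_sol e a x ->
  (forall t, a <= t < a + h ->
    `|G a (x a) - G t (x a + (t - a) *: G a (x a))| <= e) ->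
  exists2 y, approx_sol e (a + h) y & y 0 = x 0.
Proof.
move=> a0 /andP[h0 h1] [cx Cx dx] He.
pose v := G a (x a).
pose y t := x (Num.min t a) + Num.max (t - a) 0 *: v.
have ylt t : t <= a -> y t = x t.
  by move=> ta; rewrite /y min_l// max_r ?subr_le0// scale0r addr0.
have ygt t : a <= t -> y t = x a + (t - a) *: v.
  by move=> ta; rewrite /y min_r// max_l ?subr_ge0.
have Cxa : C (x a) by apply: Cx; rewrite a0 lexx.
exists y; last exact: ylt.
split.
- move=> t; apply: cvgD.
    apply: continuous_comp; last exact: cx.
    exact: (@continuous_min R R id (cst a)) cvg_id (cvg_cst _).
  apply: cvgZr_tmp.
  apply: (@continuous_max R R (fun t => t - a) (cst 0)); last exact: cvg_cst.
  by apply: cvgB; [exact: cvg_id|exact: cvg_cst].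
- move=> t /andP[t0 tah]; have [ta|/ltW at_] := leP t a.
    by rewrite ylt//; apply: Cx; rewrite t0.
  by rewrite ygt//; apply: (step_in sys) => //; apply/andP; split; lra.
- move=> t /andP[t0 tah]; have [ta|at_] := ltP t a.
    near=> s; rewrite (ylt t (ltW ta)) (ylt s); last first.
      by rewrite ltW//; near: s; exact: nbhs_right_lt.
    by near: s; apply: dx; rewrite t0.
  near=> s; have ts : t < s by near: s; exact: nbhs_right_gt.
  rewrite (ygt t)// ygt; last by rewrite (le_trans at_)// ltW.
  set w := x a + (t - a) *: v.
  have -> : x a + (s - a) *: v - (w + (s - t) *: G t w) =
      (s - t) *: (v - G t w).
    rewrite /w (_ : s - a = (t - a) + (s - t)); last by ring.
    by rewrite scalerDl addrA opprD addrACA subrr add0r -scalerBr.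
  rewrite normrZ gtr0_norm ?subr_gt0// mulrC ler_wpM2r ?subr_ge0 ?(ltW ts)//.
  by apply: He; rewrite at_.
Unshelve. all: by end_near. Qed.

Lemma field_bound t z p M : C z -> C p -> T p = p -> `|z - p| <= M ->
  `|f z - T z| <= 2 * M + `|f p - p| /\ `|G t z| <= 2 * M + `|f p - p|.
Proof.
move=> Cz Cp Tp zM; have /andP[t0 t1] := vs_theta sys t.
have /andP[c0 c1] := vs_c sys.
have fz : `|f z - p| <= M + `|f p - p|.
  have := ler_distD (f p) (f z) p; have := vs_contr sys Cz Cp.
  have : 0 <= c * `|z - p| by rewrite mulr_ge0// ltW.
  lra.
have Tz : `|T z - p| <= M.
  by have := vs_nonexp sys Cz Cp; rewrite Tp => h; exact: le_trans h zM.
split; first by have := ler_distD p (f z) (T z); rewrite (distrC p); lra.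
have -> : G t z = theta t *: (f z - p) + (1 - theta t) *: (T z - p) - (z - p).
  rewrite /field /visc !scalerBr addrACA -opprD -scalerDl subrKC scale1r.
  by rewrite opprB addrA subrK.
apply: le_trans (ler_normB _ _) _.
have := ler_normD (theta t *: (f z - p)) ((1 - theta t) *: (T z - p)).
rewrite !normrZ (gtr0_norm t0) ger0_norm ?subr_ge0//.
have := ler_wpM2l (ltW t0) fz.
have := ler_wpM2l (_ : 0 <= 1 - theta t) Tz; rewrite subr_ge0 => /(_ t1).
have : (1 - theta t) * `|f p - p| >= 0 by rewrite mulr_ge0// subr_ge0.
lra.
Qed.

(** [M] is the a priori distance to [p], and [K] bounds the field and [f - T] within that distance.
    Over a step shorter than [h0] the field changes by at most [e / 2] through [theta] and, being
    2-Lipschitz, by at most [2 h0 K <= e / 2] through the displacement. *)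
Lemma approx_sol_exists e b p (x0 : H) : 0 < e -> 0 <= b -> C x0 -> C p -> T p = p ->
  exists2 x, approx_sol e b x & x 0 = x0.
Proof.
move=> e0 b0 Cx0 Cp Tp.
pose M := `|x0 - p| + (e + `|f p - p|) * b.
pose K := 2 * M + `|f p - p| + 1.
have M0 : 0 <= M by rewrite addr_ge0// mulr_ge0// addr_ge0// ltW.
have K0 : 0 < K by rewrite ltr_wpDl// addr_ge0// mulr_ge0.
have eK0 : 0 < e / (2 * K) by rewrite divr_gt0// mulr_gt0.
have [d d0 hd] := vs_theta_unif sys b eK0.
pose h0 := Num.min 1 (Num.min d (e / (4 * K))).
have h00 : 0 < h0 by rewrite !lt_min ltr01 d0 divr_gt0// mulr_gt0.
pose N := Num.bound (b / h0).
pose h := b / N.+1%:R.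
have hle : h < h0.
  rewrite /h ltr_pdivrMr ?ltr0n// mulrC -ltr_pdivrMr//.
  by rewrite (lt_trans (archi_boundP _)) ?ltr_nat// divr_ge0// ltW.
have step k : (k <= N.+1)%N ->
    exists2 x, approx_sol e (k%:R * h) x & x 0 = x0.
  elim: k => [_|k IH kN].
    exists (cst x0) => //; rewrite mul0r; split => //.
      by move=> ?; exact: cvg_cst.
    by move=> t /andP[t0 /(le_lt_trans t0)]; rewrite ltxx.
  have [x xa x00] := IH (ltnW kN).
  have [b00|bN0] := eqVneq b 0.
    by exists x => //; move: xa; rewrite /h b00 !mul0r !mulr0.
  have h_gt0 : 0 < h by rewrite divr_gt0// lt_neqAle eq_sym bN0.
  have h_le1 : h <= 1 by rewrite ltW// (lt_le_trans hle)// ge_min lexx.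
  set a := k%:R * h in xa.
  have a0 : 0 <= a by rewrite mulr_ge0// ltW.
  have aSk : k.+1%:R * h = a + h by rewrite -natr1 mulrDl mul1r.
  have ahb : a + h <= b.
    rewrite -aSk (@le_trans _ _ (N.+1%:R * h))//; first by rewrite ler_wpM2r ?ler_nat// ltW.
    by rewrite /h mulrCA divff ?mulr1// pnatr_eq0.
  have aa : 0 <= a <= a by rewrite a0 lexx.
  have Cz : C (x a) by have [_ + _] := xa; apply.
  have zM : `|x a - p| <= M.
    apply: le_trans (approx_sol_dist xa (approx_sol_fix a Cp Tp) aa) _.
    rewrite x00 lerD2l; apply: ler_wpM2l; last lra.
    by rewrite addr_ge0// ltW.
  have [fz Gz] := field_bound a Cz Cp Tp zM.
  rewrite aSk -x00; apply: (approx_sol_extend a0 _ xa); first by rewrite h_gt0.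
  move=> t /andP[at_ tah].
  have ta01 : 0 <= t - a <= 1 by apply/andP; split; lra.
  have Cw := step_in sys a Cz ta01.
  apply: le_trans (ler_distD (G t (x a)) _ _) _.
  have h1 : `|G a (x a) - G t (x a)| <= e / (2 * K) * K.
    rewrite field_time normrZ; apply: ler_pM => //.
      rewrite distrC ltW// hd//; first lra.
      rewrite (lt_le_trans (_ : _ < h0))//; first lra.
      by rewrite /h0 !ge_min lexx orbT.
    by rewrite (le_trans fz)// /K lerDl.
  have h2 : `|G t (x a) - G t (x a + (t - a) *: G a (x a))| <= 2 * (h0 * K).
    apply: le_trans (field_lip sys t Cz Cw) _; rewrite ler_wpM2l//.
    rewrite opprD addrA subrr add0r normrN normrZ; apply: ler_pM => //.
      by rewrite ger0_norm; lra.
    by rewrite (le_trans Gz)// /K lerDl.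
  have h3 : e / (2 * K) * K = e / 2 by field; rewrite gt_eqF.
  have h4 : h0 * K <= e / 4.
    have -> : e / 4 = e / (4 * K) * K by field; rewrite gt_eqF.
    by rewrite ler_wpM2r ?(ltW K0)// /h0 !ge_min lexx !orbT.
  lra.
have [x xa x00] := step _ (leqnn _); exists x => //.
by move: xa; rewrite /h mulrCA divff ?mulr1// pnatr_eq0.
Qed.

End approximate_solutions.

Arguments approx_sol {R H} C f T theta e b x.

(** * Passage to the limit *)

Section solution.
Context {R : realType} {H : completeNormedModType R} {C : set H}
  {f T : H -> H} {theta : R -> R} {c : R}.
Implicit Types (x y : R -> H) (z p v : H) (t s a b h e : R).

Local Notation G := (field f T theta).

(** The proviso [P] serves sequences of polygons whose [n]-th member is controlled only up to time
    [n]; the rate is kept because it makes the convergence locally uniform. *)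
Lemma cauchy_rate (u : nat -> H) (r : nat -> R) (P : nat -> Prop) :
  (\forall n \near \oo, P n) ->
  (forall n m, P n -> (n <= m)%N -> `|u n - u m| <= r n) ->
  r @ \oo --> 0 ->
  exists l, u @ \oo --> l /\ forall n, P n -> `|u n - l| <= r n.
Proof.
move=> [N _ hN] hu r0.
have cu : cvgn u.
  apply/cauchy_cvgP/cauchy_ballP => e e0; near_simpl.
  have e20 : 0 < e / 2 by rewrite divr_gt0.
  have /cvgr0Pnorm_lt/(_ _ e20)[M _ hM] := r0.
  pose K := maxn N M.
  have NK : P K by apply: hN; exact: leq_maxl.
  have rK : r K < e / 2.
    by apply: le_lt_trans (ler_norm _) (hM K _); exact: leq_maxr.
  exists ([set n | (K <= n)%N], [set n | (K <= n)%N]) => /=.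
    by split; exists K.
  move=> [n m] /= [Kn Km]; rewrite -ball_normE /=.
  have := ler_distD (u K) (u n) (u m); have := hu _ _ NK Kn.
  have := hu _ _ NK Km; rewrite (distrC (u K) (u n)); lra.
have [l ul] := (cvg_ex _).1 cu; exists l; split => // n Nn.
apply/ler_addgt0Pr => e e0.
have /cvgrPdist_le/(_ _ e0)[M _ hM] := ul.
have := hM (maxn n M) (leq_maxr _ _).
have := hu n (maxn n M) Nn (leq_maxl _ _).
have := ler_distD (u (maxn n M)) (u n) l.
by rewrite /= (distrC l); lra.
Unshelve. all: by end_near. Qed.

Hypothesis sys : viscosity_system C f T theta c.

Lemma lip_comp_continuous (g : H -> H) x :
  (forall z p, C z -> C p -> `|g z - g p| <= `|z - p|) ->
  (forall t, C (x t)) -> continuous x -> continuous (g \o x).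
Proof.
move=> lg Cx cx t; apply/cvgrPdist_le => e e0; near=> s.
apply: le_trans (lg _ _ (Cx t) (Cx s)) _.
by near: s; move/cvgrPdist_le : (cx t); apply.
Unshelve. all: by end_near. Qed.

Lemma field_continuous x : (forall t, C (x t)) -> continuous x ->
  continuous (fun t => G t (x t)).
Proof.
move=> Cx cx t; apply: cvgB; last exact: cx.
have /andP[c0 c1] := vs_c sys.
have cf : continuous (f \o x).
  apply: lip_comp_continuous => // z p Cz Cp.
  apply: le_trans (vs_contr sys Cz Cp) _.
  by rewrite ler_piMl// gerBl ltW.
have cT : continuous (T \o x) by apply: lip_comp_continuous => //; exact: (vs_nonexp sys).
have ct := vs_theta_cont sys.
apply: cvgD; apply: cvgZ; [exact: ct|exact: cf| |exact: cT].
by apply: cvgB; [exact: cvg_cst|exact: ct].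
Qed.

(** The last clause is an integral-free form of the statement that [x] is a primitive of the field
    along it. It survives the limit because it holds for all [s >= t], whereas the neighbourhood of
    [t] in the one-step estimate depends on the polygon. *)
Lemma limit_solution p (x0 : H) : C x0 -> C p -> T p = p ->
  exists x, [/\ continuous x, forall t, C (x t), x 0 = x0 &
    forall t s v e, 0 <= t -> t <= s ->
      (forall r, t <= r <= s -> `|G r (x r) - v| <= e) ->
      `|x s - x t - (s - t) *: v| <= e * (s - t)].
Proof.
move=> Cx0 Cp Tp.
have /choice[xn xnP] : forall n : nat, exists x,
    approx_sol C f T theta n.+1%:R^-1 n%:R x /\ x 0 = x0.
  move=> n; have n0 : 0 < n.+1%:R^-1 :> R by rewrite invr_gt0.
  have [x xa x00] := approx_sol_exists sys n0 (ler0n R n) Cx0 Cp Tp.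
  by exists x.
have xa n := (xnP n).1; have xn0 n := (xnP n).2.
(* Polygons of index at least [n] have defects at most [n.+1%:R^-1], and two of them add up over the
   time [u]. *)
pose r u n : R := 2 * u * n.+1%:R^-1.
have r0 u : r u @ \oo --> 0.
  by rewrite -(mulr0 (2 * u)); apply: cvgM; [exact: cvg_cst|exact: cvg_harmonic].
pose pos t : R := Num.max 0 t.
have pos0 t : 0 <= pos t by rewrite le_max lexx.
have bound t : exists N : nat, pos t <= N%:R.
  by exists (Num.bound (pos t)); rewrite ltW// archi_boundP.
have /choice[x' x'P] : forall t, exists l,
    xn n (pos t) @[n --> \oo] --> l /\
    forall n : nat, pos t <= n%:R -> `|xn n (pos t) - l| <= r (pos t) n.
  move=> t; apply: cauchy_rate; last exact: r0.
    have [N tN] := bound t; exists N => // n /= Nn.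
    by rewrite (le_trans tN)// ler_nat.
  move=> n m tn nm.
  have tm : pos t <= m%:R by rewrite (le_trans tn)// ler_nat.
  have xma : approx_sol C f T theta n.+1%:R^-1 n%:R (xn m).
    by apply: approx_sol_le (xa m); rewrite ?ler_nat// lef_pV2 ?posrE// ler_nat.
  have tn' : 0 <= pos t <= n%:R by rewrite pos0.
  have := approx_sol_dist sys (xa n) xma tn'.
  have E (i u : R) : (i + i) * u = 2 * u * i by ring.
  by rewrite !xn0 subrr normr0 add0r E.
have posK t : pos (pos t) = pos t by rewrite {1}/pos max_r.
pose x := x' \o pos.
have xP t : xn n (pos t) @[n --> \oo] --> x t /\
    forall n : nat, pos t <= n%:R -> `|xn n (pos t) - x t| <= r (pos t) n.
  by have := x'P (pos t); rewrite posK.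
have rle u w n : u <= w -> r u n <= r w n.
  by move=> uw; rewrite /r ler_wpM2r ?invr_ge0// ler_wpM2l.
have rsmall u e : 0 < e -> exists n : nat, u <= n%:R /\ r u n <= e.
  move=> e0; have /cvgr0Pnorm_le/(_ _ e0)[M _ hM] := r0 u.
  pose N := Num.bound `|u|; exists (maxn N M); split.
    apply: (le_trans (ler_norm u)).
    apply: (@le_trans _ _ N%:R); first by rewrite ltW// archi_boundP.
    by rewrite ler_nat leq_maxl.
  by apply: le_trans (ler_norm _) (hM _ _); exact: leq_maxr.
have cx : continuous x.
  move=> t; apply/cvgrPdist_le => e e0; have e30 : 0 < e / 3 by rewrite divr_gt0.
  have [N [tN rN]] := rsmall (`|t| + 1) _ e30.
  have cN : {for t, continuous (xn N \o pos)}.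
    apply: continuous_comp; last by have [+ _ _] := xa N; apply.
    exact: (@continuous_max R R (cst 0) id) (cvg_cst _) cvg_id.
  have posB s : s <= `|t| + 1 -> pos s <= `|t| + 1.
    by move=> h; rewrite ge_max h addr_ge0.
  have xN s : s <= `|t| + 1 -> `|xn N (pos s) - x s| <= e / 3.
    move=> /posB h; apply: le_trans ((xP s).2 N _) _; first exact: le_trans tN.
    by apply: le_trans rN; exact: rle.
  near=> s.
  have st : s <= `|t| + 1.
    have : `|t - s| < 1 by near: s; exact: (nbhsx_ballx t 1 ltr01).
    by rewrite ltr_distl; have := ler_norm t; lra.
  have tt : t <= `|t| + 1 by have := ler_norm t; lra.
  have h : `|xn N (pos t) - xn N (pos s)| <= e / 3.
    by near: s; move/cvgrPdist_le : cN; apply.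
  have := ler_distD (xn N (pos t)) (x t) (x s).
  have := ler_distD (xn N (pos s)) (xn N (pos t)) (x s).
  have := xN _ st; have := xN _ tt; rewrite (distrC _ (x t)); lra.
have Cx t : C (x t).
  apply: (closed_cvg C (vs_closed sys) _ (x t) (xP t).1).
  have [N tN] := bound t; exists N => // n /= Nn.
  by have [_ + _] := xa n; apply; rewrite pos0 (le_trans tN)// ler_nat.
exists x; split => //.
  have pos00 : pos 0 = 0 by rewrite /pos max_l.
  have := (xP 0).2 0%N; rewrite pos00 => /(_ (lexx _)).
  by rewrite /r mulr0 mul0r normr_le0 subr_eq0 xn0 => /eqP.
have posid u : 0 <= u -> pos u = u by move=> u0; rewrite /pos max_r.
move=> t s v e t0 ts hv; have s0 : 0 <= s by exact: le_trans ts.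
apply/ler_addgt0Pr => d d0.
(* Budget for [d]: errors of total rate [3 dl] act over a time of at most [s], and replacing the
   polygon by its limit costs [dl] at each end. *)
have s10 : 0 < 3 * s + 3 by lra.
have [dl d20 dlE] : exists2 dl, 0 < dl & dl * (3 * s + 3) = d.
  by exists (d / (3 * s + 3)); [exact: divr_gt0|rewrite divfK ?gt_eqF].
(* Taken at [s + 1] rather than [s], the rate dominates the defect [n.+1%:R^-1] even when
   [s = 0]. *)
have [n [sn rn]] := rsmall (s + 1) _ d20.
have xnx u : 0 <= u -> u <= s -> `|xn n u - x u| <= dl.
  move=> u0 us; have := (xP u).2 n; rewrite posid// => h.
  apply: le_trans (h _) (le_trans (rle _ _ _ _) rn); lra.
have en : n.+1%:R^-1 <= dl.
  apply: le_trans rn; rewrite /r ler_peMl ?invr_ge0//; lra.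
have [cxn Cxn dxn] := xa n.
have main : `|xn n s - xn n t - (s - t) *: v| - (e + 3 * dl) * (s - t) <=
   `|xn n t - xn n t - (t - t) *: v| - (e + 3 * dl) * (t - t).
  apply: (@right_locally_nonincreasing _ (fun u => `|xn n u - xn n t - (u - t) *: v| -
      (e + 3 * dl) * (u - t))) => //.
    move=> u _.
    have cut : {for u, continuous (fun u : R => u - t)}.
      by apply: cvgB; [exact: cvg_id|exact: cvg_cst].
    apply: cvgB; last by apply: cvgM; [exact: cvg_cst|exact: cut].
    apply: cvg_norm; apply: cvgB; last by apply: cvgZr_tmp; exact: cut.
    by apply: cvgB; [exact: cxn|exact: cvg_cst].
  move=> u /andP[tu us] e' e'0.
  have u0 : 0 <= u by exact: le_trans tu.
  have un' : u <= n%:R by lra.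
  have un : 0 <= u < n%:R by rewrite u0; lra.
  near=> w.
  have uw : 0 < w - u by rewrite subr_gt0; near: w; exact: nbhs_right_gt.
  have h1 : `|xn n w - (xn n u + (w - u) *: G u (xn n u))| <= dl * (w - u).
    apply: (@le_trans _ _ (n.+1%:R^-1 * (w - u))); first by near: w; exact: dxn.
    by apply: ler_wpM2r => //; exact: ltW.
  have h2 : `|G u (xn n u) - v| <= 2 * dl + e.
    apply: le_trans (ler_distD (G u (x u)) _ _) _; apply: lerD; last first.
      by apply: hv; rewrite tu ltW.
    apply: le_trans (field_lip sys u _ (Cx u)) _.
      by apply: Cxn; rewrite u0 un'.
    by rewrite ler_wpM2l// xnx// ltW.
  have -> : xn n w - xn n t - (w - t) *: v =
      (xn n u - xn n t - (u - t) *: v) + (w - u) *: (G u (xn n u) - v) +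
      (xn n w - (xn n u + (w - u) *: G u (xn n u))).
    rewrite (_ : w - t = (u - t) + (w - u)); last by ring.
    have E (A B a b D w' : H) :
        w' - B - (a + b) = (A - B - a) + (D - b) + (w' - (A + D)).
      have -> : A - B - a + (D - b) = (A + D) - (B + a + b).
        by rewrite -[A - B - a]addrA -opprD addrACA -opprD.
      by rewrite [RHS]addrC addrA subrK -addrA -opprD addrA.
    by rewrite scalerDl scalerBr; exact: E.
  have h3 := ler_normD ((xn n u - xn n t - (u - t) *: v) + (w - u) *: (G u (xn n u) - v))
    (xn n w - (xn n u + (w - u) *: G u (xn n u))).
  have h4 := ler_normD (xn n u - xn n t - (u - t) *: v) ((w - u) *: (G u (xn n u) - v)).
  rewrite normrZ (gtr0_norm uw) in h4.
  have h5 : (w - u) * `|G u (xn n u) - v| <= (w - u) * (2 * dl + e).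
    by apply: ler_wpM2l => //; exact: ltW.
  have h7 : 0 <= e' * (w - u) by rewrite mulr_ge0// ltW.
  lra.
rewrite !subrr scale0r subr0 normr0 mulr0 in main.
have -> : x s - x t - (s - t) *: v = (xn n s - xn n t - (s - t) *: v) -
    ((xn n s - x s) - (xn n t - x t)).
  have -> : xn n s - x s - (xn n t - x t) = (xn n s - xn n t) - (x s - x t).
    by rewrite opprD addrACA -opprD.
  by rewrite opprB [RHS]addrC addrA subrK.
have := xnx _ t0 ts; have := xnx _ s0 (lexx s) => hs ht.
have h1 := ler_normB (xn n s - xn n t - (s - t) *: v) ((xn n s - x s) - (xn n t - x t)).
have h2 := ler_normB (xn n s - x s) (xn n t - x t).
have h4 : 0 <= dl * t by rewrite mulr_ge0// ltW.
lra.
Unshelve. all: by end_near.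
Qed.

End solution.

(** * Derivatives within the half-line *)

Section derivatives_on_the_halfline.
Context {R : realType} {H : normedModType R}.
Implicit Types (x g : R -> H) (t s e : R).

Lemma has_derivative_atP x t v : has_derivative_at x t v <->
  forall e, 0 < e -> exists2 d, 0 < d & forall s, 0 <= s -> `|s - t| < d ->
    `|x s - x t - (s - t) *: v| <= e * `|s - t|.
Proof.
have quot s : s != t ->
    `|v - (s - t)^-1 *: (x s - x t)| = `|x s - x t - (s - t) *: v| / `|s - t|.
  move=> st; have st0 : s - t != 0 by rewrite subr_eq0.
  have -> : v - (s - t)^-1 *: (x s - x t) =
      - ((s - t)^-1 *: (x s - x t - (s - t) *: v)).
    by rewrite (scalerBr _ (_ - _)) scalerA mulVf// scale1r opprB.
  by rewrite normrN normrZ normfV mulrC.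
split=> [/cvgrPdist_le xv e e0|xv].
  have [d /= d0 hd] := xv _ e0; exists d => // s s0 sd.
  have [->|st] := eqVneq s t; first by rewrite !subrr scale0r subr0 !normr0 mulr0.
  have := hd s; rewrite /= distrC quot// ler_pdivrMr; last first.
    by rewrite normr_gt0 subr_eq0.
  by apply => //; rewrite in_itv /= s0.
apply/cvgrPdist_le => e e0; have [d d0 hd] := xv _ e0.
exists d => //= s sd st; rewrite in_itv /= andbT => s0.
rewrite quot// ler_pdivrMr ?normr_gt0 ?subr_eq0//.
by apply: hd => //; rewrite distrC.
Qed.

Lemma has_derivative_right x t v e : 0 <= t -> has_derivative_at x t v -> 0 < e ->
  \forall s \near t^'+, `|x s - x t - (s - t) *: v| <= e * (s - t).
Proof.
move=> t0 /has_derivative_atP + e0 => /(_ _ e0)[d d0 hd]; near=> s.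
have ts : t < s by near: s; exact: nbhs_right_gt.
have sd : s < t + d by near: s; apply: nbhs_right_lt; rewrite ltrDl.
have st : `|s - t| = s - t by rewrite gtr0_norm// subr_gt0.
by have := hd s; rewrite st; apply; lra.
Unshelve. all: by end_near. Qed.

Lemma has_derivative_continuous x : (forall t, 0 <= t -> exists v, has_derivative_at x t v) ->
  continuous (fun t => x (Num.max 0 t)).
Proof.
move=> dx t; apply/cvgrPdist_le => e e0.
have [v /has_derivative_atP/(_ _ ltr01)[d d0 hd]] : exists v, has_derivative_at x (Num.max 0 t) v.
  by apply: dx; rewrite le_max lexx.
have v0 : 0 < `|v| + 1 by rewrite ltr_wpDl.
pose d' := Num.min d (e / (`|v| + 1)).
have d'0 : 0 < d' by rewrite lt_min d0 divr_gt0.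
near=> s.
have ts : `|t - s| < d' by near: s; exact: (nbhsx_ballx t d' d'0).
have ss : `|Num.max 0 s - Num.max 0 t| <= `|t - s|.
  rewrite !maxEle; do 2 case: ifPn; rewrite -?ltNge => ? ?;
  rewrite ler_norml; have := ler_norm (t - s); have := ler_norm (s - t);
  rewrite (distrC s); lra.
have sd' : `|Num.max 0 s - Num.max 0 t| < d' by exact: le_lt_trans ts.
have := hd (Num.max 0 s); rewrite le_max lexx => /(_ isT).
move: sd'; rewrite lt_min => /andP[sd se] /(_ sd); rewrite mul1r => h.
rewrite distrC; rewrite ltr_pdivlMr// in se.
have := ler_normD (x (Num.max 0 s) - x (Num.max 0 t) - (Num.max 0 s - Num.max 0 t) *: v)
  ((Num.max 0 s - Num.max 0 t) *: v).
rewrite subrK normrZ; lra.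
Unshelve. all: by end_near. Qed.

(** Since [v] is arbitrary and not tied to the left end point, the increment estimate also serves
    for [s < t]: it is used on [[s, t]] with [v = g t]. *)
Lemma has_derivative_of_increments x g : continuous g ->
  (forall t s v e, 0 <= t -> t <= s ->
    (forall r, t <= r <= s -> `|g r - v| <= e) ->
    `|x s - x t - (s - t) *: v| <= e * (s - t)) ->
  forall t, 0 <= t -> has_derivative_at x t (g t).
Proof.
move=> cg hx t t0; apply/has_derivative_atP => e e0.
have /cvgrPdist_le/(_ _ e0)[d /= d0 hd] := cg t.
exists d => // s s0 sd.
have [ts|/ltW st] := leP t s.
  rewrite ger0_norm ?subr_ge0//; apply: hx => // r /andP[tr rs].
  rewrite distrC; apply: hd => /=; apply: le_lt_trans sd.
  by rewrite distrC !ger0_norm ?subr_ge0// lerB.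
have -> : x s - x t - (s - t) *: g t = - (x t - x s - (t - s) *: g t).
  by rewrite opprB -(opprB t s) scaleNr opprK [RHS]addrC opprB addrC.
rewrite normrN (distrC s t) ger0_norm ?subr_ge0//; apply: hx => // r /andP[sr rt].
rewrite distrC; apply: hd => /=; apply: le_lt_trans sd.
by rewrite [leRHS]distrC !ger0_norm ?subr_ge0// lerB.
Qed.

End derivatives_on_the_halfline.

(** * Exact solutions *)

Section trajectories.
Context {R : realType} {H : completeNormedModType R} {C : set H}
  {f T : H -> H} {theta : R -> R} {c : R}.
Hypothesis sys : viscosity_system C f T theta c.
Implicit Types (x y : R -> H) (z p v : H) (t s a b h e : R).

Local Notation G := (field f T theta).

Definition solution (C : set H) f T theta x :=
  (forall t, 0 <= t -> C (x t)) /\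
  forall t, 0 <= t -> has_derivative_at x t (field f T theta t (x t)).

Lemma solution_exists p (x0 : H) : C x0 -> C p -> T p = p ->
  exists x, [/\ solution C f T theta x, x 0 = x0,
    continuous (fun t => G t (x t)) & continuous x].
Proof.
move=> Cx0 Cp Tp; have [x [cx Cx x00 hx]] := limit_solution sys Cx0 Cp Tp.
have cG := field_continuous sys Cx cx.
by exists x; split => //; split => //; exact: has_derivative_of_increments hx.
Qed.

Lemma solution_continuous x : solution C f T theta x ->
  continuous (fun t => x (Num.max 0 t)).
Proof.
by move=> [_ dx]; apply: has_derivative_continuous => t t0; eexists; exact: dx.
Qed.

Lemma solution_near x t e : solution C f T theta x -> 0 <= t -> 0 < e ->
  \forall s \near t^'+, `|x s - (x t + (s - t) *: G t (x t))| <= e * (s - t).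
Proof.
move=> [_ dx] t0 e0; have := has_derivative_right t0 (dx _ t0) e0.
by apply: filterS => s; rewrite opprD addrA.
Qed.

Lemma solution_approx x e b : solution C f T theta x -> 0 < e ->
  approx_sol C f T theta e b (fun t => x (Num.max 0 t)).
Proof.
move=> sx e0; split; first exact: solution_continuous.
  by move=> t _; apply: sx.1; rewrite le_max lexx.
move=> t /andP[t0 _]; near=> s.
have ts : t < s by near: s; exact: nbhs_right_gt.
have s0 : 0 <= s by rewrite (le_trans t0)// ltW.
rewrite !max_r//; near: s; exact: solution_near.
Unshelve. all: by end_near. Qed.

(** An exact solution is [e]-approximate for every [e > 0], so the distance bound, linear in time,
    becomes arbitrarily small. *)
Lemma solution_unique x y t : solution C f T theta x ->
  solution C f T theta y -> x 0 = y 0 -> 0 <= t -> x t = y t.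
Proof.
move=> sx sy xy0 t0; apply/eqP; rewrite -subr_eq0 -normr_le0.
apply/ler_addgt0Pr => e e0; rewrite add0r.
have t10 : 0 < t + 1 by lra.
have e20 : 0 < e / (2 * (t + 1)) by rewrite divr_gt0// mulr_gt0.
have tt : 0 <= t <= t by rewrite t0 lexx.
have := approx_sol_dist sys (solution_approx t sx e20) (solution_approx t sy e20) tt.
rewrite !max_r// xy0 subrr normr0 add0r => h; apply: le_trans h _.
have -> : e / (2 * (t + 1)) + e / (2 * (t + 1)) = e / (t + 1).
  by field; rewrite gt_eqF.
by rewrite -mulrA ler_piMr ?(ltW e0)// mulrC ler_pdivrMr// mul1r lerDl.
Qed.

End trajectories.

(** * Asymptotic regularity *)

Section asymptotic_regularity.
Context {R : realType} {H : completeNormedModType R} {C : set H}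
  {f T : H -> H} {theta Theta : R -> R} {c : R}.
Hypothesis sys : viscosity_system C f T theta c.
Hypothesis dTheta : forall t : R, 0 <= t -> is_derive t 1 Theta (theta t).
Hypothesis Theta_y : Theta t @[t --> +oo] --> +oo.
Implicit Types (X : R -> H) (y z p v : H) (t s a b h e k : R).

Local Notation F := (visc f T theta).
Local Notation G := (field f T theta).

Lemma Theta_continuous t : 0 <= t -> {for t, continuous Theta}.
Proof.
by move=> /dTheta[d _]; apply/differentiable_continuous/derivable1_diffP.
Qed.

Lemma Theta_nondecreasing s t : 0 <= s -> s <= t -> Theta s <= Theta t.
Proof.
move=> s0 st; rewrite -lerN2.
apply: (@right_locally_nonincreasing _ (fun u => - Theta u)) => //.
  by move=> u /andP[su _]; apply: cvgN; apply: Theta_continuous; exact: le_trans su.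
move=> u /andP[su _] e e0; have u0 : 0 <= u by exact: le_trans su.
near=> w.
have uw : 0 < w - u by rewrite subr_gt0; near: w; exact: nbhs_right_gt.
have : `|Theta w - Theta u - (w - u) * theta u| <= e * (w - u).
  by near: w; apply: is_derive_right_near => //; exact: dTheta.
rewrite ler_norml; have /andP[h _] := vs_theta sys u.
have : 0 <= (w - u) * theta u by rewrite mulr_ge0// ltW.
by move=> ? /andP[? _]; lra.
Unshelve. all: by end_near. Qed.

Lemma expR_Theta_le1 k s t : 0 <= k -> 0 <= s -> s <= t ->
  expR (- (k * (Theta t - Theta s))) <= 1.
Proof.
move=> k0 s0 st; rewrite -expR0 ler_expR oppr_le0 mulr_ge0// subr_ge0.
exact: Theta_nondecreasing.
Qed.

(** By [1 + x <= exp x], a growth of [Theta] by [|Q| / (e k)] suffices. *)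
Lemma expR_Theta_small k s e (Q : R) : 0 < k -> 0 < e ->
  \forall t \near +oo, expR (- (k * (Theta t - Theta s))) * Q <= e.
Proof.
move=> k0 e0; have /cvgryPge/(_ (Theta s + `|Q| / (e * k))) := Theta_y.
apply: filterS => t ht.
apply: (@le_trans _ _ (expR (- (k * (Theta t - Theta s))) * `|Q|)).
  by rewrite ler_wpM2l ?expR_ge0// ler_norm.
rewrite expRN mulrC ler_pdivrMr ?expR_gt0//.
have h1 : `|Q| / e <= k * (Theta t - Theta s).
  have : k * (`|Q| / (e * k)) <= k * (Theta t - Theta s).
    by apply: ler_wpM2l; [exact: ltW|lra].
  have -> // : k * (`|Q| / (e * k)) = `|Q| / e.
  by field; rewrite !gt_eqF.
have h2 := expR_ge1Dx (k * (Theta t - Theta s)).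
have h3 : e * (`|Q| / e) <= e * expR (k * (Theta t - Theta s)).
  by apply: ler_wpM2l; [exact: ltW|lra].
by rewrite mulrCA divff ?mulr1 ?gt_eqF// in h3.
Qed.

Definition orbit X := [/\ continuous X, forall t, C (X t) &
  forall t e, 0 <= t -> 0 < e -> \forall s \near t^'+,
    `|X s - (X t + (s - t) *: G t (X t))| <= e * (s - t)].

(** The field at [p] has norm [theta |f p - p|], while Euler steps contract distances at rate
    [c theta]; the two balance at [m = |f p - p| / c], the level used in Gronwall's inequality. *)
Lemma orbit_bounded X p : orbit X -> C p -> T p = p ->
  exists2 M, 0 <= M & forall t, 0 <= t -> `|X t - p| <= M.
Proof.
move=> [cX CX dX] Cp Tp; have /andP[c0 c1] := vs_c sys.
pose m := `|f p - p| / c.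
exists (m + `| `|X 0 - p| - m |); first by rewrite addr_ge0// divr_ge0// ltW.
move=> t t0.
have : `|X t - p| - m <= expR (- (c * (Theta t - Theta 0))) * (`|X 0 - p| - m).
  apply: (@gronwall _ theta Theta (fun u => `|X u - p|)) => //.
  - by move=> u /andP[u0 _]; exact: dTheta.
  - move=> u _; apply: cvg_norm; apply: cvgB; [exact: cX|exact: cvg_cst].
  - move=> u /andP[u0 _] e e0; near=> s.
    have /andP[su0 su1] : 0 < s - u <= 1 by near: s; exact: near_right_short.
    have su01 : 0 <= s - u <= 1 by rewrite ltW.
    have h1 : `|X s - (X u + (s - u) *: G u (X u))| <= e * (s - u).
      by near: s; exact: dX.
    have h2 := step_contr sys u (CX u) Cp su01.
    have h3 : `|p + (s - u) *: G u p - p| = (s - u) * (theta u * `|f p - p|).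
      rewrite addrAC subrr add0r field_fix// !normrZ (gtr0_norm su0) gtr0_norm//.
      by case/andP: (vs_theta sys u).
    have h4 := ler_distD (X u + (s - u) *: G u (X u)) (X s) p.
    have h5 := ler_distD (p + (s - u) *: G u p) (X u + (s - u) *: G u (X u)) p.
    have h6 : c * m = `|f p - p| by rewrite /m mulrC divfK// gt_eqF.
    have -> : c * theta u * (m - `|X u - p|) =
      theta u * `|f p - p| - c * theta u * `|X u - p| by rewrite -h6; ring.
    lra.
have h1 : expR (- (c * (Theta t - Theta 0))) * (`|X 0 - p| - m) <=
    `| `|X 0 - p| - m |.
  apply: le_trans (ler_norm _) _; rewrite normrM ger0_norm ?expR_ge0//.
  by rewrite ler_piMl// expR_Theta_le1// ltW.
lra.
Unshelve. all: by end_near. Qed.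

(* The Krasnoselskii step [y + k (F y - y)] does not increase the residual of a
   nonexpansive [F]; here [F] is moreover allowed to vary with time. *)
Lemma residual_step y s t k : C y -> 0 <= k <= 1 ->
  `|G s (y + k *: G t y)| <=
    (1 - k * (c * theta s)) * `|G t y| + `|theta s - theta t| * `|f y - T y|.
Proof.
move=> Cy /andP[k0 k1]; set y' := y + _.
have Cy' : C y' by apply: (step_in sys) => //; rewrite k0.
have E (a1 a2 a3 a4 : H) : a1 - a4 = (a1 - a2) + (a2 - a3) + (a3 - a4).
  by rewrite !addrA !subrK.
have -> : G s y' = (F s y' - F s y) + (F s y - F t y) + (F t y - y') by exact: E.
have -> : F t y - y' = (1 - k) *: G t y.
  by rewrite scalerBl scale1r /y' /field opprD addrA.
rewrite visc_time; set w := (theta s - theta t) *: _.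
have h1 := ler_normD ((F s y' - F s y) + w) ((1 - k) *: G t y).
have h2 := ler_normD (F s y' - F s y) w.
rewrite [in X in _ <= X]normrZ in h2.
rewrite [`|_ *: G t y|]normrZ [`|1 - k|]ger0_norm ?subr_ge0// in h1.
have h3 := visc_contr sys s Cy' Cy.
have yy' : `|y' - y| = k * `|G t y|.
  by rewrite /y' addrAC subrr add0r normrZ ger0_norm.
rewrite yy' in h3; lra.
Qed.

(** Gronwall's inequality is applied to the residual minus [K W]: the subtraction absorbs the
    increments of [W], and the remaining forcing [K e theta] balances the contraction at the level
    [m = K e / c]. *)
Lemma residual_cvg0 X p : orbit X -> C p -> T p = p ->
  (forall e, 0 < e -> exists (A : R) (W : R -> R),
    [/\ 0 < A, forall t, A <= t -> {for t, continuous W},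
      forall t, A <= t -> 0 <= W t <= e &
      forall s t, A <= s -> s <= t ->
        `|theta t - theta s| <= W t - W s + e * (Theta t - Theta s)]) ->
  `|G t (X t)| @[t --> +oo] --> 0.
Proof.
move=> oX Cp Tp smallvar; have [cX CX dX] := oX.
have [M M0 XM] := orbit_bounded oX Cp Tp.
have /andP[c0 c1] := vs_c sys.
pose K := 2 * M + `|f p - p| + 1.
have K0 : 0 < K by have := normr_ge0 (f p - p); rewrite /K; lra.
have fT t : 0 <= t -> `|f (X t) - T (X t)| <= K.
  move=> t0; have [h _] := field_bound sys t (CX t) Cp Tp (XM _ t0).
  by rewrite (le_trans h)// lerDl.
apply/cvgr0Pnorm_le => e1 e10.
(* The residual ends below [e] for the exponential tail, plus [m = e K / c], plus [K e] for the
   bound on [K W]: altogether [e B]. *)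
pose B := K + K / c + 1.
have Kc0 := divr_ge0 (ltW K0) (ltW c0).
have B0 : 0 < B by rewrite /B; lra.
pose e := e1 / B.
have e0 : 0 < e by rewrite divr_gt0.
have [A [W [A0 cW We Wvar]]] := smallvar _ e0.
pose m := K * e / c.
near=> b.
have Ab : A <= b by near: b; apply: nbhs_pinfty_ge; exact: num_real.
have expb : expR (- (c * (Theta b - Theta A))) *
    (`|G A (X A)| - K * W A - m) <= e.
  by near: b; exact: expR_Theta_small.
have : (`|G b (X b)| - K * W b) - m <= expR (- (c * (Theta b - Theta A))) *
    (`|G A (X A)| - K * W A - m).
  apply: (@gronwall _ theta Theta (fun u => `|G u (X u)| - K * W u)) => //.
  - by move=> u /andP[Au _]; apply: dTheta; rewrite (le_trans (ltW A0)).
  - move=> u /andP[Au _]; apply: cvgB; last by apply: cvgM; [exact: cvg_cst|exact: cW].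
    by apply: cvg_norm; exact: (field_continuous sys CX cX).
  - move=> t /andP[At tb] d d0; have t0 : 0 <= t by rewrite (le_trans (ltW A0)).
    (* The tolerance [d] is halved: the defect [d / 4], doubled by the 2-Lipschitz field, and
       [d' * Q] for the linearisation of [Theta] and the variation of [theta]. *)
    pose Q := `|G t (X t)| + K * e + 1.
    have Ke0' := mulr_ge0 (ltW K0) (ltW e0).
    have Q0 : 0 < Q by have := normr_ge0 (G t (X t)); rewrite /Q; lra.
    pose d' := d / (2 * Q).
    have d'0 : 0 < d' by rewrite divr_gt0// mulr_gt0.
    have d40 : 0 < d / 4 by rewrite divr_gt0.
    near=> s.
    have /andP[st0 st1] : 0 < s - t <= 1 by near: s; exact: near_right_short.
    have ts : t <= s by rewrite -subr_ge0 ltW.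
    have st01 : 0 <= s - t <= 1 by rewrite ltW.
    have h1 : `|X s - (X t + (s - t) *: G t (X t))| <= d / 4 * (s - t).
      by near: s; exact: dX.
    have h2 := residual_step s t (CX t) st01.
    have h3 := field_lip sys s (CX s) (step_in sys t (CX t) st01).
    have h4 := ler_distD (G s (X t + (s - t) *: G t (X t))) (G s (X s)) 0.
    rewrite !subr0 in h4.
    have h5 := Wvar _ _ At ts.
    have h6 : `|theta s - theta t| * `|f (X t) - T (X t)| <=
        (W s - W t + e * (Theta s - Theta t)) * K.
      by apply: ler_pM => //; exact: fT.
    have h7 : `|Theta s - Theta t - (s - t) * theta t| <= d' * (s - t).
      by near: s; apply: is_derive_right_near => //; exact: dTheta.
    have h8 : `|theta t - theta s| <= d'.
      near: s; apply: cvgr_dist_le d'0; apply: cvg_at_right_filter.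
      exact: (vs_theta_cont sys).
    have st_ge0 := ltW st0.
    have h9 := ler_wpM2l (ltW K0) h5.
    move: h8; rewrite ler_distl => /andP[_ h8].
    move: h7; rewrite ler_distl => /andP[_ h7].
    have q0 : 0 <= `|G t (X t)| by exact: normr_ge0.
    have Ke0 : 0 <= K * e by rewrite mulr_ge0// ltW.
    have cm : c * m = K * e by rewrite /m mulrC divfK// gt_eqF.
    have d'Q : d' * Q = d / 2 by rewrite /d'; field; rewrite gt_eqF.
    have /andP[Wt0 _] := We _ At.
    have /andP[tt0 _] := vs_theta sys t.
    have f1 := ler_wpM2l Ke0 h7.
    have f2 : (s - t) * (c * (`|G t (X t)| * (theta t - d'))) <=
        (s - t) * (c * (`|G t (X t)| * theta s)).
      apply: ler_wpM2l => //; apply: ler_wpM2l; first exact: ltW.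
      by apply: ler_wpM2l => //; rewrite lerBlDr.
    have f3 : (s - t) * (c * (d' * `|G t (X t)|)) <= (s - t) * (d' * `|G t (X t)|).
      by apply: ler_wpM2l => //; rewrite ler_piMl// mulr_ge0// ltW.
    have f4 : (s - t) * (d' * (`|G t (X t)| + K * e)) <= (s - t) * (d / 2).
      by apply: ler_wpM2l => //; rewrite -d'Q ler_pM2l// /Q lerDl.
    have f5 : 0 <= (s - t) * (c * theta t * (K * W t)).
      by rewrite !mulr_ge0// ltW.
    have -> : c * theta t * (m - (`|G t (X t)| - K * W t)) =
      theta t * (K * e) - c * theta t * `|G t (X t)| + c * theta t * (K * W t).
      by rewrite -cm; ring.
    lra.
have /andP[_ Wb] := We _ Ab.
have KWb : K * W b <= K * e by apply: ler_wpM2l => //; exact: ltW.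
have eB : e + m + K * e = e1.
  have -> : e + m + K * e = e * B by rewrite /m /B; ring.
  by rewrite /e divfK// gt_eqF.
rewrite normr_id; lra.
Unshelve. all: by end_near. Qed.

End asymptotic_regularity.

Arguments orbit {R H} C f T theta X.

(** * The variational problem *)

Lemma contraction_fixed_point (R : realType) (H : completeNormedModType R)
    (C : set H) (h : H -> H) (k : R) :
  closed C -> C !=set0 -> (forall x, C x -> C (h x)) -> 0 <= k < 1 ->
  (forall x y, C x -> C y -> `|h x - h y| <= k * `|x - y|) ->
  exists2 p, C p & h p = p.
Proof.
move=> clC C0 hC /andP[k0 k1] hk.
pose h' : {fun C >-> C} := HB.pack h (isFun.Build _ _ C C h hC).
have [|p Cp hp] := @banach_fixed_point R H C h' _ clC C0; last by exists p.
exists (NngNum k0); split => //= -[x y] /= [Cx Cy]; exact: hk.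
Qed.

(** * Inner product identities *)

Section inner_product.
Context {R : realType} {H : completeNormedModType R}
  {ip : {dot H for (@idfun R)}}.
Hypothesis ip_norm : induces_norm ip.
Implicit Types (u v w x y z p q : H).

Lemma ipC u v : ip u v = ip v u.
Proof. by rewrite hermC expr0 mul1r. Qed.

Lemma ip_sqr u : ip u u = `|u| ^+ 2.
Proof.
rewrite ip_norm sqr_sqrtr//; have [->|u0] := eqVneq u 0; first by rewrite linear0l.
by apply: ltW; exact: neq0_dnorm_gt0.
Qed.

Lemma ipDl u v w : ip (u + v) w = ip u w + ip v w.
Proof. exact: linearDl. Qed.

Lemma ipBl u v w : ip (u - v) w = ip u w - ip v w.
Proof. exact: linearBl. Qed.

Lemma ipDr u v w : ip u (v + w) = ip u v + ip u w.
Proof. by rewrite !(ipC u) ipDl. Qed.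

Lemma ipBr u v w : ip u (v - w) = ip u v - ip u w.
Proof. by rewrite !(ipC u) ipBl. Qed.

Lemma ipZl (a : R) u v : ip (a *: u) v = a * ip u v.
Proof. exact: linearZl_LR. Qed.

Lemma ipZr (a : R) u v : ip u (a *: v) = a * ip u v.
Proof. by rewrite !(ipC u) ipZl. Qed.

Lemma ipNl u v : ip (- u) v = - ip u v.
Proof. exact: linearNl. Qed.

Lemma ipNr u v : ip u (- v) = - ip u v.
Proof. by rewrite !(ipC u) ipNl. Qed.

Lemma normD_sqr u v : `|u + v| ^+ 2 = `|u| ^+ 2 + 2 * ip u v + `|v| ^+ 2.
Proof. by rewrite -!ip_sqr ipDl !ipDr (ipC v u); ring. Qed.

Lemma normB_sqr u v : `|u - v| ^+ 2 = `|u| ^+ 2 - 2 * ip u v + `|v| ^+ 2.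
Proof. by rewrite normD_sqr ipNr normrN mulrN. Qed.

(** Cauchy-Schwarz, read off by squaring the triangle inequality for the induced norm. *)
Lemma ip_le_norm u v : ip u v <= `|u| * `|v|.
Proof.
have : `|u + v| ^+ 2 <= (`|u| + `|v|) ^+ 2.
  by rewrite ler_sqr ?nnegrE ?addr_ge0// ler_normD.
by rewrite normD_sqr; lra.
Qed.

(** Lets an inequality at the limit [q] be tested at a nearby point [z] of the resolvent curve. *)
Lemma ip_perturb u q x z : ip (u - q) (x - q) <=
  ip (u - z) (x - z) + `|z - q| * (`|u - q| + `|z - q| + `|x - q|).
Proof.
have -> : ip (u - q) (x - q) =
    ip (u - z) (x - z) + ip (u - z) (z - q) + ip (z - q) (x - q).
  by rewrite !ipBl !ipBr; ring.
have h1 := ip_le_norm (u - z) (z - q).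
have h2 := ip_le_norm (z - q) (x - q).
have h3 : `|u - z| * `|z - q| <= (`|u - q| + `|z - q|) * `|z - q|.
  by apply: ler_wpM2r => //; rewrite (distrC z); exact: ler_distD.
lra.
Qed.

End inner_product.

(** * The resolvent curve and the variational inequality *)

Section viscosity_limit.
Context {R : realType} {H : completeNormedModType R}
  {ip : {dot H for (@idfun R)}} {C : set H} {T : H -> H}.
Hypothesis ip_norm : induces_norm ip.
Hypothesis clC : closed C.
Hypothesis convC : forall x y (k : R), C x -> C y -> 0 <= k <= 1 ->
  C ((1 - k) *: x + k *: y).
Hypothesis TC : forall x, C x -> C (T x).
Hypothesis Tne : forall x y, C x -> C y -> `|T x - T y| <= `|x - y|.
Implicit Types (u v w x y z p q : H) (a b k l m e : R).

Lemma nonexpansive_monotone x y : C x -> C y ->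
  0 <= ip ((x - T x) - (y - T y)) (x - y).
Proof.
move=> Cx Cy; have E (a1 a2 a3 a4 : H) : (a1 - a2) - (a3 - a4) = (a1 - a3) - (a2 - a4).
  by rewrite opprD addrACA -opprD.
rewrite E ipBl (ip_sqr ip_norm) subr_ge0.
apply: le_trans (ip_le_norm ip_norm _ _) _.
by rewrite expr2 ler_wpM2r//; exact: Tne.
Qed.

(** With [k = (1 + l)^-1] the equation reads [z = (1 - k) u + k T z], a fixed point equation for a
    contraction of [C] with coefficient [k < 1]. *)
Lemma resolvent_exists u l : C u -> 0 < l ->
  exists2 z, C z & z - T z = l *: (u - z).
Proof.
move=> Cu l0; have l10 : 0 < 1 + l by lra.
pose k := (1 + l)^-1.
have k0 : 0 < k by rewrite invr_gt0.
have k1 : k < 1 by rewrite invf_lt1//; lra.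
have [z Cz hz] : exists2 z, C z & (1 - k) *: u + k *: T z = z.
  apply: (@contraction_fixed_point _ _ C (fun z => (1 - k) *: u + k *: T z) k) => //.
  - by exists u.
  - by move=> x Cx; apply: convC => //; [exact: TC|rewrite !ltW].
  - by rewrite ltW.
  - move=> x y Cx Cy; rewrite opprD addrACA subrr add0r -scalerBr normrZ gtr0_norm//.
    by rewrite ler_pM2l//; exact: Tne.
exists z => //.
have : (1 + l) *: z = l *: u + T z.
  rewrite -{1}hz scalerDr !scalerA /k divff ?gt_eqF// scale1r.
  by rewrite mulrBr mulr1 divff ?gt_eqF// addrAC subrr add0r.
rewrite scalerDl scale1r scalerBr => zE.
by apply/eqP; rewrite subr_eq addrAC -zE addrK.
Qed.

(** With [w = x - u] and [v = y - u], monotonicity of [I - T] expands to [(l + m) |w - v|^2 <= (l -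
    m) (|v|^2 - |w|^2)]. Hence the last difference is nonnegative, and [l - m] may be enlarged to
    [l + m]. *)
Lemma resolvent_dist u l m x y : 0 < m -> m < l -> C x -> C y ->
  x - T x = l *: (u - x) -> y - T y = m *: (u - y) ->
  `|x - y| ^+ 2 <= `|y - u| ^+ 2 - `|x - u| ^+ 2.
Proof.
move=> m0 ml Cx Cy xE yE; have := nonexpansive_monotone Cx Cy.
set w := x - u; set v := y - u.
have -> : x - T x - (y - T y) = m *: v - l *: w.
  by rewrite xE yE -(opprB x u) -(opprB y u) !scalerN opprK addrC.
have xy : x - y = w - v by rewrite /w /v opprB addrA subrK.
clearbody w v; rewrite xy ipBl !ipZl !ipBr !(ip_sqr ip_norm) (ipC v w) (normB_sqr ip_norm) => h.
have h1 : (l + m) * (`|w| ^+ 2 - 2 * ip w v + `|v| ^+ 2) <=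
  (l - m) * (`|v| ^+ 2 - `|w| ^+ 2) by lra.
rewrite -(normB_sqr ip_norm) in h1 *.
have n0 : 0 <= `|w - v| ^+ 2 by rewrite exprn_ge0.
have lm0 : 0 < l - m by lra.
have D0 : 0 <= `|v| ^+ 2 - `|w| ^+ 2.
  rewrite -(pmulr_rge0 _ lm0); apply: le_trans h1.
  by rewrite mulr_ge0//; lra.
rewrite -(ler_pM2l (_ : 0 < l + m)); last lra.
apply: le_trans h1 _; rewrite ler_wpM2r//; lra.
Qed.

(** Monotonicity of [I - T] is used against [p], where [I - T] vanishes. The norm bound keeps the
    resolvent curve bounded. *)
Lemma resolvent_fix u l z p : 0 < l -> C z -> C p -> T p = p ->
  z - T z = l *: (u - z) ->
  0 <= ip (u - z) (z - p) /\ `|z - u| <= `|u - p|.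
Proof.
move=> l0 Cz Cp Tp zE; have := nonexpansive_monotone Cz Cp.
rewrite Tp subrr subr0 zE ipZl pmulr_rge0// => h; split => //.
rewrite -ler_sqr ?nnegrE//.
have -> : u - p = (u - z) + (z - p) by rewrite addrA subrK.
rewrite (normD_sqr ip_norm (u - z)) (distrC z).
have : 0 <= `|z - p| ^+ 2 by rewrite exprn_ge0.
lra.
Qed.

(* Browder's convergence theorem for the curve [z_l] with
   [z_l - T z_l = l (u - z_l)]: along [l -> 0] the norms [|z_l - u|] increase,
   and [resolvent_dist] turns their convergence into that of [z_l]. *)
Lemma resolvent_limit u p0 : C u -> C p0 -> T p0 = p0 ->
  exists q, [/\ C q, T q = q,
    forall p, C p -> T p = p -> ip (u - q) (p - q) <= 0 &
    forall e, 0 < e -> exists z l,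
      [/\ 0 < l, C z, z - T z = l *: (u - z) & `|z - q| <= e]].
Proof.
move=> Cu Cp0 Tp0.
pose l (n : nat) : R := n.+1%:R^-1.
have l0 n : 0 < l n by rewrite invr_gt0.
have /choice[z zP] : forall n, exists z, C z /\ z - T z = l n *: (u - z).
  by move=> n; have [z Cz zE] := resolvent_exists Cu (l0 n); exists z.
have Cz n := (zP n).1; have zE n := (zP n).2.
pose a n := `|z n - u| ^+ 2.
have dist n (m : nat) : (n <= m)%N -> `|z n - z m| ^+ 2 <= a m - a n.
  rewrite leq_eqVlt => /predU1P[->|nm].
    by rewrite !subrr normr0 expr0n.
  apply: (@resolvent_dist u (l n) (l m)) => //.
  by rewrite ltf_pV2 ?posrE// ltr_nat.
have nda : nondecreasing_seq a.
  by move=> n m /dist h; rewrite -subr_ge0 (le_trans _ h)// exprn_ge0.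
have uba : has_ubound (range a).
  exists (`|u - p0| ^+ 2) => _ [n _ <-]; rewrite ler_sqr ?nnegrE//.
  by have [] := resolvent_fix (l0 n) (Cz n) Cp0 Tp0 (zE n).
have ca := nondecreasing_cvgn nda uba.
set L := sup _ in ca.
have aL n : a n <= L by apply: ub_le_sup => //; exists n.
have [q [zq _]] : exists q, z @ \oo --> q /\
    forall n, True -> `|z n - q| <= Num.sqrt (L - a n).
  apply: (@cauchy_rate _ _ z _ (fun=> True)).
  - by exists 0%N.
  - move=> n m _ nm; rewrite -[leLHS]ger0_norm// -sqrtr_sqr ler_wsqrtr//.
    by apply: le_trans (dist _ _ nm) _; rewrite lerB.
  - have cLa : (fun n => L - a n) @ \oo --> L - L.
      by apply: cvgB; [exact: cvg_cst|exact: ca].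
    have := cvg_comp _ _ cLa (@sqrt_continuous R (L - L)).
    by rewrite subrr sqrtr0.
have Cq : C q by apply: (closed_cvg C clC _ q zq); exact: nearW.
have appr e : 0 < e -> exists n, `|z n - q| <= e /\ l n <= e.
  move=> e0; have /cvgrPdist_le/(_ _ e0)[N1 _ h1] := zq.
  have /cvgr0Pnorm_le/(_ _ e0)[N2 _ h2] := @cvg_harmonic R.
  exists (maxn N1 N2); split.
    by rewrite distrC; apply: h1; exact: leq_maxl.
  by apply: le_trans (ler_norm _) (h2 _ _); exact: leq_maxr.
exists q; split => //.
- apply/eqP; rewrite eq_sym -subr_eq0 -normr_le0; apply/ler_addgt0Pr => e e0.
  rewrite add0r; have B0 : 0 < 2 + `|u - p0| by rewrite ltr_wpDr.
  have [n [zn ln]] := appr _ (divr_gt0 e0 B0).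
  have [_ zu] := resolvent_fix (l0 n) (Cz n) Cp0 Tp0 (zE n).
  have h1 := ler_distD (z n) q (T q); have h2 := ler_distD (T (z n)) (z n) (T q).
  have h3 := Tne (Cz n) Cq; rewrite zE normrZ (gtr0_norm (l0 n)) (distrC u) in h2.
  have h4 : l n * `|z n - u| <= e / (2 + `|u - p0|) * `|u - p0|.
    by apply: ler_pM => //; exact: ltW.
  have h5 : e / (2 + `|u - p0|) * (2 + `|u - p0|) = e by rewrite divfK// gt_eqF.
  by rewrite (distrC q (z n)) in h1; lra.
- move=> p Cp Tp; apply/ler_addgt0Pr => e e0; rewrite add0r.
  have B0 : 0 < `|u - q| + 1 + `|p - q| by rewrite ltr_wpDr// ltr_wpDl.
  have m0 : 0 < Num.min 1 (e / (`|u - q| + 1 + `|p - q|)).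
    by rewrite lt_min ltr01 divr_gt0.
  have [n []] := appr _ m0; rewrite le_min => /andP[zn1 zne] _.
  have [h _] := resolvent_fix (l0 n) (Cz n) Cp Tp (zE n).
  apply: le_trans (ip_perturb ip_norm u q p (z n)) _.
  rewrite -(opprB (z n) p) ipNr.
  have h1 : `|z n - q| * (`|u - q| + `|z n - q| + `|p - q|) <=
    e / (`|u - q| + 1 + `|p - q|) * (`|u - q| + 1 + `|p - q|).
    by apply: ler_pM => //; rewrite ?addr_ge0// lerD2r lerD2l.
  by rewrite divfK ?gt_eqF// in h1; lra.
- by move=> e /appr[n [zn _]]; exists (z n), (l n).
Qed.

(** Adding the two inequalities gives [|q - q'|^2 <= <u - v, q - q'>]; this is the nonexpansiveness
    of the projection. *)
Lemma variational_dist u v q q' : ip (u - q) (q' - q) <= 0 ->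
  ip (v - q') (q - q') <= 0 -> `|q - q'| ^+ 2 <= `|u - v| * `|q - q'|.
Proof.
move=> h1 h2; apply: le_trans (ip_le_norm ip_norm _ _).
by move: h1 h2; rewrite -(ip_sqr ip_norm) !ipBl !ipBr; lra.
Qed.

Lemma variational_unique (f : H -> H) k q q' : k < 1 -> C q -> C q' ->
  (forall x y, C x -> C y -> `|f x - f y| <= k * `|x - y|) ->
  ip (f q - q) (q' - q) <= 0 -> ip (f q' - q') (q - q') <= 0 -> q' = q.
Proof.
move=> k1 Cq Cq' fk h1 h2; have h := variational_dist h1 h2.
have h3 : `|f q - f q'| * `|q - q'| <= k * `|q - q'| ^+ 2.
  by rewrite expr2 mulrA ler_wpM2r//; exact: fk.
have d0 : 0 <= `|q - q'| ^+ 2 by rewrite exprn_ge0.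
have : (1 - k) * `|q - q'| ^+ 2 <= 0 by lra.
rewrite pmulr_rle0 ?subr_gt0// => d1.
have : `|q - q'| ^+ 2 == 0 by rewrite eq_le d1 d0.
by rewrite sqrf_eq0 normr_eq0 subr_eq0 => /eqP.
Qed.

(** The approximation of [q] by the resolvent curve of [f q] is carried along because trajectories
    are later compared with points of that curve. *)
Lemma variational_exists (f : H -> H) k p0 : 0 <= k < 1 ->
  (forall x, C x -> C (f x)) ->
  (forall x y, C x -> C y -> `|f x - f y| <= k * `|x - y|) ->
  C p0 -> T p0 = p0 ->
  exists q, [/\ C q, T q = q,
    forall p, C p -> T p = p -> ip (f q - q) (p - q) <= 0 &
    forall e, 0 < e -> exists z l,
      [/\ 0 < l, C z, z - T z = l *: (f q - z) & `|z - q| <= e]].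
Proof.
move=> k01 fC fk Cp0 Tp0.
pose good u q := [/\ C q, T q = q,
    forall p, C p -> T p = p -> ip (u - q) (p - q) <= 0 &
    forall e, 0 < e -> exists z l,
      [/\ 0 < l, C z, z - T z = l *: (u - z) & `|z - q| <= e]].
have /choice[P PP] : forall u, exists q, C u -> good u q.
  move=> u; have [Cu|nCu] := pselect (C u); last by exists u.
  by have [q qP] := resolvent_limit Cu Cp0 Tp0; exists q.
have [q Cq qE] : exists2 q, C q & P (f q) = q.
  apply: (@contraction_fixed_point _ _ C (P \o f) k) => //.
  - by exists p0.
  - by move=> x /fC /PP[].
  - move=> x y Cx Cy.
    have [C1 T1 V1 _] := PP _ (fC _ Cx); have [C2 T2 V2 _] := PP _ (fC _ Cy).
    have h := variational_dist (V1 _ C2 T2) (V2 _ C1 T1).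
    apply: le_trans (fk _ _ Cx Cy); rewrite /=.
    have [->|n0] := eqVneq `|P (f x) - P (f y)| 0; first by [].
    by move: h; rewrite expr2 ler_pM2r// lt_neqAle eq_sym n0 normr_ge0.
by exists q; have := PP _ (fC _ Cq); rewrite qE.
Qed.

End viscosity_limit.

(** * Convergence *)

Section convergence.
Context {R : realType} {H : completeNormedModType R}
  {ip : {dot H for (@idfun R)}} {C : set H} {f T : H -> H}
  {theta Theta : R -> R} {c : R}.
Hypothesis ip_norm : induces_norm ip.
Hypothesis sys : viscosity_system C f T theta c.
Hypothesis dTheta : forall t : R, 0 <= t -> is_derive t 1 Theta (theta t).
Hypothesis Theta_y : Theta t @[t --> +oo] --> +oo.
Implicit Types (X : R -> H) (y z p q v : H) (t s a b e k : R).

Local Notation F := (visc f T theta).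
Local Notation G := (field f T theta).

(** [X - T X = theta (f X - T X) - G], and [f X - T X] is bounded along the orbit. *)
Lemma fixed_residual_cvg0 X p : orbit C f T theta X -> C p -> T p = p ->
  theta t @[t --> +oo] --> 0 -> `|G t (X t)| @[t --> +oo] --> 0 ->
  `|X t - T (X t)| @[t --> +oo] --> 0.
Proof.
move=> oX Cp Tp theta0 G0; have [_ CX _] := oX.
have [M M0 XM] := orbit_bounded sys dTheta oX Cp Tp.
pose K := 2 * M + `|f p - p|.
have h0 : `|G t (X t)| + theta t * K @[t --> +oo] --> 0.
  rewrite -[X in _ --> X]add0r -[X in _ --> _ + X](mul0r K).
  by apply: cvgD => //; apply: cvgM => //; exact: cvg_cst.
apply: (squeeze_cvgr _ (cvg_cst 0) h0); near=> t.
have t0 : 0 <= t by near: t; apply: nbhs_pinfty_ge; exact: num_real.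
rewrite normr_ge0 /=.
have [fT _] := field_bound sys t (CX t) Cp Tp (XM _ t0).
have /andP[th0 _] := vs_theta sys t.
have -> : X t - T (X t) = theta t *: (f (X t) - T (X t)) - G t (X t).
  have E (a x z : H) : x - z = a - (z + a - x).
    by rewrite opprB [RHS]addrC opprD addrA subrK.
  by rewrite /field viscE; exact: E.
apply: le_trans (ler_normB _ _) _; rewrite addrC lerD2l normrZ (gtr0_norm th0).
by rewrite ler_wpM2l// ltW.
Unshelve. all: by end_near. Qed.

(** The point [z] and its [l] are fixed beforehand. Monotonicity gives
    [l <f q - z, X - z> <= <X - T X, X - z>], and [t] is then so large that the residual outweighs
    the factor [1 / l]; moving from [z] to [q] costs another [e / 2]. *)
Lemma orbit_variational X q e : orbit C f T theta X -> C q -> T q = q ->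
  (forall d, 0 < d -> exists z l,
    [/\ 0 < l, C z, z - T z = l *: (f q - z) & `|z - q| <= d]) ->
  `|X t - T (X t)| @[t --> +oo] --> 0 -> 0 < e ->
  \forall t \near +oo, ip (f q - q) (X t - q) <= e.
Proof.
move=> oX Cq Tq appr res0 e0; have [_ CX _] := oX.
have [M M0 XM] := orbit_bounded sys dTheta oX Cq Tq.
pose Q := `|f q - q| + 1 + M.
have Q0 : 0 < Q by have := normr_ge0 (f q - q); rewrite /Q; lra.
pose d := Num.min 1 (e / (2 * Q)).
have d0 : 0 < d by rewrite lt_min ltr01 divr_gt0// mulr_gt0.
have [z [l [l0 Cz zE zq]]] := appr _ d0.
move: zq; rewrite le_min => /andP[zq1 zqe].
have r0 : 0 < l * (e / 2) / (M + 1) by rewrite divr_gt0 ?mulr_gt0//; lra.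
near=> t.
have t0 : 0 <= t by near: t; apply: nbhs_pinfty_ge; exact: num_real.
have h1 : `|X t - T (X t)| <= l * (e / 2) / (M + 1).
  near: t; move/cvgr0Pnorm_le : res0 => /(_ _ r0).
  by apply: filterS => t; rewrite normr_id.
have h2 := nonexpansive_monotone ip_norm (vs_nonexp sys) (CX t) Cz.
have h3 := ip_perturb ip_norm (f q) q (X t) z.
have Xq := XM _ t0.
have h4 : `|z - q| * (`|f q - q| + `|z - q| + `|X t - q|) <= e / (2 * Q) * Q.
  by apply: ler_pM => //; rewrite /Q; lra.
have h5 : e / (2 * Q) * Q = e / 2 by field; rewrite gt_eqF.
have h6 : ip (z - T z) (X t - z) <= ip (X t - T (X t)) (X t - z).
  by move: h2; rewrite ipBl subr_ge0.
have h7 := ip_le_norm ip_norm (X t - T (X t)) (X t - z).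
have Xz : `|X t - z| <= M + 1.
  by have := ler_distD q (X t) z; rewrite (distrC q z); lra.
have h8 : `|X t - T (X t)| * `|X t - z| <= l * (e / 2) / (M + 1) * (M + 1).
  exact: ler_pM.
rewrite divfK in h8; last by rewrite gt_eqF//; lra.
have h9 : ip (f q - z) (X t - z) <= e / 2.
  by rewrite -(ler_pM2l l0) -ipZl -zE; lra.
lra.
Unshelve. all: by end_near. Qed.

Lemma field_ip t x q : C x -> C q -> T q = q ->
  ip (G t x) (x - q) <=
    theta t * ip (f q - q) (x - q) - c * theta t * `|x - q| ^+ 2.
Proof.
move=> Cx Cq Tq.
have -> : G t x = (F t x - F t q) - (x - q) + theta t *: (f q - q).
  have E (a b y z : H) : a - y = (a - b) - (y - z) + (b - z).
    by rewrite opprB addrAC !addrA !subrK.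
  by rewrite -(field_fix (f := f) (theta := theta) t Tq); exact: E.
rewrite (ipDl (F t x - F t q - (x - q))) (ipBl (F t x - F t q)) ipZl (ip_sqr ip_norm).
have := ip_le_norm ip_norm (F t x - F t q) (x - q).
have h : `|F t x - F t q| * `|x - q| <= (1 - c * theta t) * `|x - q| * `|x - q|.
  by rewrite ler_wpM2r//; exact: (visc_contr sys).
rewrite expr2; lra.
Qed.

(** The right derivative of [|X - q|^2] is [2 <G, X - q>], eventually at most
    [2 theta e - 2 c theta |X - q|^2]: Gronwall's inequality applies with rate [2 c] and level
    [e / c]. *)
Lemma orbit_cvg X q : orbit C f T theta X -> C q -> T q = q ->
  (forall e, 0 < e -> \forall t \near +oo, ip (f q - q) (X t - q) <= e) ->
  X t @[t --> +oo] --> q.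
Proof.
move=> oX Cq Tq var; have [cX CX dX] := oX.
have /andP[c0 c1] := vs_c sys.
apply/cvgrPdist_le => e1 e10.
have c10 : 0 < c^-1 + 1 by rewrite ltr_wpDl// invr_ge0 ltW.
(* Chosen so that the level [e / c] and the exponential tail [e] add up to [e1 ^+ 2]. *)
pose e := e1 ^+ 2 / (c^-1 + 1).
have e0 : 0 < e by rewrite divr_gt0// exprn_gt0.
have [A [_ hA]] := var _ e0.
pose A1 := Num.max 0 (A + 1).
have A10 : 0 <= A1 by rewrite le_max lexx.
have AA1 : A < A1 by rewrite lt_max ltrDl ltr01 orbT.
have c20 : 0 < 2 * c by lra.
near=> b.
have A1b : A1 <= b by near: b; apply: nbhs_pinfty_ge; exact: num_real.
have expb : expR (- (2 * c * (Theta b - Theta A1))) *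
    (`|X A1 - q| ^+ 2 - e / c) <= e.
  by near: b; exact: expR_Theta_small.
have main : `|X b - q| ^+ 2 - e / c <= expR (- (2 * c * (Theta b - Theta A1))) *
    (`|X A1 - q| ^+ 2 - e / c).
  apply: (@gronwall _ theta Theta (fun u => `|X u - q| ^+ 2)) => //.
  - by move=> u /andP[Au _]; apply: dTheta; rewrite (le_trans A10).
  - move=> u _; have cn : {for u, continuous (fun u => `|X u - q|)}.
      by apply: cvg_norm; apply: cvgB; [exact: cX|exact: cvg_cst].
    exact: (continuous_comp cn (@exprn_continuous R 2 _)).
  - move=> t /andP[At tb] d d0; have t0 : 0 <= t by rewrite (le_trans A10).
    set w := X t - q; set g := G t (X t).
    have wg : ip g w <= theta t * e - c * theta t * `|w| ^+ 2.
      apply: le_trans (field_ip t (CX t) Cq Tq) _; rewrite lerD2r.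
      have /andP[th0 _] := vs_theta sys t; rewrite ler_pM2l//.
      by apply: hA; rewrite (lt_le_trans AA1).
    (* [Q] collects the error terms in the expansion of the squared one-step estimate. *)
    pose Q := 2 * (`|w| + `|g|) + 1 + `|g| ^+ 2.
    have g20 : 0 <= `|g| ^+ 2 by rewrite exprn_ge0.
    have w0 : 0 <= `|w| by []. have g0 : 0 <= `|g| by [].
    have Q0 : 0 < Q by rewrite /Q; lra.
    pose d' := Num.min 1 (d / Q).
    have d'0 : 0 < d' by rewrite lt_min ltr01 divr_gt0.
    have d'1 : d' <= 1 by rewrite ge_min lexx.
    have d'Q : d' * Q <= d by rewrite -ler_pdivlMr// ge_min lexx orbT.
    near=> s.
    have /andP[st0 std] : 0 < s - t <= d' by near: s; exact: near_right_short.
    have st1 : s - t <= 1 by exact: le_trans d'1.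
    have h1 : `|X s - (X t + (s - t) *: g)| <= d' * (s - t).
      by near: s; exact: dX.
    have h2 : `|X s - q| <= `|w + (s - t) *: g| + d' * (s - t).
      have -> : X s - q = (w + (s - t) *: g) + (X s - (X t + (s - t) *: g)).
        have E (a y z v : H) : a - z = (y - z + v) + (a - (y + v)).
          by rewrite (addrAC y) [RHS]addrC addrA subrK.
        exact: E.
      by apply: le_trans (ler_normD _ _) _; rewrite lerD2l.
    have h3 : `|w + (s - t) *: g| <= `|w| + `|g|.
      apply: le_trans (ler_normD _ _) _; rewrite lerD2l normrZ gtr0_norm//.
      by rewrite ler_piMl.
    have h4 : `|w + (s - t) *: g| ^+ 2 =
        `|w| ^+ 2 + 2 * ((s - t) * ip g w) + (s - t) ^+ 2 * `|g| ^+ 2.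
      by rewrite (normD_sqr ip_norm) ipZr (ipC w) normrZ gtr0_norm// exprMn.
    have h5 : `|X s - q| ^+ 2 <= (`|w + (s - t) *: g| + d' * (s - t)) ^+ 2.
      by rewrite ler_sqr ?nnegrE// addr_ge0// mulr_ge0// ltW.
    have st_ge0 := ltW st0.
    have d't0 : 0 <= d' * (s - t) by rewrite mulr_ge0// ltW.
    have k1 : `|w + (s - t) *: g| * (d' * (s - t)) <=
      (`|w| + `|g|) * (d' * (s - t)) by exact: ler_wpM2r.
    have k2 : (s - t) * ((s - t) * `|g| ^+ 2) <= (s - t) * (d' * `|g| ^+ 2).
      by apply: ler_wpM2l => //; exact: ler_wpM2r.
    have k3 : (d' * (s - t)) * (d' * (s - t)) <= d' * (s - t).
      by rewrite ler_piMr// mulr_ile1// ltW.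
    have k4 := ler_wpM2l st_ge0 wg.
    have k5 := ler_wpM2l st_ge0 d'Q.
    have -> : 2 * c * theta t * (e / c - `|w| ^+ 2) =
      2 * theta t * e - 2 * c * theta t * `|w| ^+ 2 by field; rewrite gt_eqF.
    rewrite /Q in k5; lra.
rewrite distrC -ler_sqr ?nnegrE ?(ltW e10)//.
have ec : e / c + e = e1 ^+ 2.
  have -> : e / c + e = e * (c^-1 + 1) by ring.
  by rewrite /e divfK// gt_eqF.
by rewrite -ec -lerBlDl (le_trans main).
Unshelve. all: by end_near. Qed.

End convergence.

(** * From trajectories to the abstract system *)

Section reduction.
Context {R : realType} {H : completeNormedModType R} {C : set H}
  {f T : {fun C >-> C}} {theta : R -> R} {alpha : {nonneg R}}.
Hypothesis C_closed : closed C.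
Hypothesis C_convex : convex_set (C : set (convex_lmodType H)).
Hypothesis f_contr : contraction alpha f.
Hypothesis T_nonexp : nonexpansive T.
Hypothesis theta_itv : forall t : R, 0 <= t -> 0 < theta t <= 1.
Hypothesis theta_ac : absolutely_continuous_halfline theta.

Local Notation thetap := (fun t => theta (Num.max 0 t)).

Lemma contraction_system :
  0 < 1 - alpha%:num -> viscosity_system C f T thetap (1 - alpha%:num).
Proof.
move=> c0; split => //.
- move=> x y k Cx Cy /andP[k0 k1].
  (* [convex_set] gives its first point the weight [k], hence the exchange of [x] and [y]. *)
  have := C_convex (Itv01 k0 k1) (mem_set Cy) (mem_set Cx).
  by rewrite inE addrC.
- by move=> x Cx; exact: funS.
- by move=> x Cx; exact: funS.
- by move=> x y Cx Cy; rewrite subKr; exact: (f_contr.2 (x, y)).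
- by move=> x y Cx Cy; have := T_nonexp (conj Cx Cy : (C `*` C) (x, y)); rewrite /= mul1r.
- by rewrite c0 gerBl ge0.
- by move=> t; apply: theta_itv; rewrite le_max lexx.
- exact: absolutely_continuous_continuous.
(* Uniform continuity is absolute continuity for families of a single interval. *)
- move=> b e e0; pose b' := Num.max 0 b.
  have b'0 : 0 <= b' by rewrite le_max lexx.
  have [d d0 hd] := ac_family_clip b'0 (theta_ac b') e0.
  exists d => // s t s0 st tb ts; have t0 : 0 <= t by exact: le_trans st.
  have tb' : t <= b' by rewrite le_max tb orbT.
  have := hd [:: (s, t)]; rewrite /= !big_seq1 st /= => /(_ isT isT ts).
  by rewrite !clip_id ?s0 ?t0 ?max_r// (le_trans st).
Qed.

Lemma trajectory_solution x0 x : trajectory f T theta x0 x ->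
  solution C f T thetap x /\ x 0 = x0.
Proof.
move=> [Cx x00 [dx [_ ddx dxE]]]; split => //; split => // t t0.
have -> : field f T thetap t (x t) = dx t; last exact: ddx.
by rewrite /field /visc max_r// -dxE// addrK.
Qed.

Lemma solution_trajectory x0 x : solution C f T thetap x -> x 0 = x0 ->
  continuous (fun t => field f T thetap t (x t)) -> trajectory f T theta x0 x.
Proof.
move=> [Cx dx] x00 cG; split => //.
exists (fun t => field f T thetap t (x t)); split => //.
  exact: continuous_subspaceT.
by move=> t t0; rewrite /field /visc subrK max_r.
Qed.

End reduction.

Theorem theorem3p1 (R : realType) (H : completeNormedModType R)
    (ip : {dot H for (@idfun R)}) (ip_norm : induces_norm ip)
    (C : set H) (C_neq0 : C !=set0) (C_closed : closed C)
    (C_convex : convex_set (C : set (convex_lmodType H)))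
    (alpha : {nonneg R}) (f : {fun C >-> C}) (f_contr : contraction alpha f)
    (T : {fun C >-> C}) (T_nonexp : nonexpansive T) (FixT_neq0 : Fix T !=set0)
    (theta : R -> R) (theta_itv : forall t : R, 0 <= t -> 0 < theta t <= 1)
    (theta_ac : absolutely_continuous_halfline theta)
    (x0 : H) (Cx0 : C x0) :
  (exists2 x : R -> H, trajectory f T theta x0 x &
     forall y, trajectory f T theta x0 y -> forall t : R, 0 <= t -> y t = x t) /\
  (theta t @[t --> +oo] --> 0 ->
   (\int[lebesgue_measure]_(t in `[0%R, +oo[) (theta t)%:E = +oo)%E ->
   (\int[lebesgue_measure]_(t in `[0%R, +oo[) `|derive1 theta t|%:E < +oo)%E \/
     ae_cvg_pinfty (fun t => derive1 theta t / theta t) 0 ->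
   exists q : H,
     [/\ solves_VP ip f T q,
         forall q', solves_VP ip f T q' -> q' = q &
         forall x, trajectory f T theta x0 x -> x t @[t --> +oo] --> q]).
Proof.
have alpha1 : alpha%:num < 1 by exact: f_contr.1.
have alpha01 : 0 <= alpha%:num < 1 by rewrite ge0.
have f_lip x y : C x -> C y -> `|f x - f y| <= alpha%:num * `|x - y|.
  by move=> Cx Cy; exact: (f_contr.2 (x, y)).
have c0 : 0 < 1 - alpha%:num by rewrite subr_gt0.
have sys := contraction_system C_closed C_convex f_contr T_nonexp theta_itv theta_ac c0.
have [p [Cp Tp]] := FixT_neq0.
split.
  have [x [sx x00 cG cx]] := solution_exists sys Cx0 Cp Tp.
  exists x; first exact: solution_trajectory.
  move=> y /trajectory_solution[sy y0] t t0.
  by apply: (solution_unique sys sy sx) => //; rewrite y0.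
move=> theta0 theta_oo theta'.
pose thetap t := theta (Num.max 0 t).
pose Theta := primitive thetap.
have cthetap : continuous thetap by exact: absolutely_continuous_continuous.
have thetap_pos t : 0 < theta (Num.max 0 t) <= 1.
  by apply: theta_itv; rewrite le_max lexx.
have dTheta (t : R) : 0 <= t -> is_derive t 1 Theta (thetap t).
  by move=> t0; apply: is_derive_primitive => //; rewrite (lt_le_trans _ t0)// ltrN10.
have Theta_y : Theta t @[t --> +oo] --> +oo.
  apply: primitive_cvgy => //; first by move=> t; case/andP: (thetap_pos t) => /ltW.
  rewrite -theta_oo; apply: eq_integral => t; rewrite inE /= in_itv /= andbT => t0.
  by rewrite /thetap max_r.
have thetap0 : thetap t @[t --> +oo] --> 0.
  apply: cvg_trans theta0; apply: near_eq_cvg; near=> t.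
  by rewrite /thetap max_r//; near: t; apply: nbhs_pinfty_ge; exact: num_real.
have [q [Cq Tq Vq approx_q]] := variational_exists ip_norm C_closed
  (vs_convex sys) (vs_T sys) (vs_nonexp sys)
  alpha01 (vs_f sys) f_lip Cp Tp.
exists q; split.
- by split => // z [Cz Tz]; exact: Vq.
- move=> q' [[Cq' Tq'] Vq'].
  apply: (variational_unique ip_norm alpha1 Cq Cq' f_lip).
  + exact: Vq.
  + exact: Vq'.
- move=> x /trajectory_solution[sx _].
  pose X t := x (Num.max 0 t).
  have oX : orbit C f T thetap X.
    split; first exact: (solution_continuous sx).
    - by move=> t; apply: sx.1; rewrite le_max lexx.
    - move=> t e t0 e0; have [_ _ h] := solution_approx (t + 1) sx e0.
      by apply: h; rewrite t0 ltrDl ltr01.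
  have res : `|field f T thetap t (X t)| @[t --> +oo] --> 0.
    apply: (residual_cvg0 sys dTheta Theta_y oX Cp Tp) => e e0.
    have [|A [W [A0 cW We Wv]]] :=
      eventually_small_variation _ theta_ac e0 theta'.
      by move=> t /theta_itv/andP[].
    exists A, W; split => // s t As st.
    have s0 : 0 <= s by rewrite (le_trans (ltW A0)).
    by rewrite /thetap !max_r ?(le_trans s0)//; exact: Wv.
  have resT := fixed_residual_cvg0 sys dTheta oX Cp Tp thetap0 res.
  have XQ : X t @[t --> +oo] --> q.
    apply: (orbit_cvg ip_norm sys dTheta Theta_y oX Cq Tq) => e e0.
    exact: (orbit_variational ip_norm sys dTheta oX Cq Tq approx_q resT e0).
  apply: cvg_trans XQ; apply: near_eq_cvg; near=> t.
  by rewrite /X max_r//; near: t; apply: nbhs_pinfty_ge; exact: num_real.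
Unshelve. all: by end_near. Qed.
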